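(* Let $\mathcal H$ be the reproducing kernel Hilbert space of holomorphic functions described in the context. Let $A$ be a self-adjoint operator on $\mathcal H$ with spectral decomposition $A=\int_{\mathbb R}\lambda\,dE_\lambda$. Let $f\in\mathcal H$ with $\Vert f\Vert_{\mathcal H}=1$, let $\mu_f:=d(\langle E_\lambda f,f\rangle_{\mathcal H})$ be the associated spectral probability measure on $\mathbb R$, and let $F_f:\mathbb R\to\mathbb C$ be the function $F_f(t)=\langle \exp(-itA)f,f\rangle_{\mathcal H}$. Then: (1) $\mu_f$ is the inverse Fourier transform of $F_f$, where $\mu_f$ and $F_f$ are considered as tempered distributions on $\mathbb R$, i.e. $\mu_f=\mathcal F^{-1}(F_f)$ in $\mathcal S'(\mathbb R)$. (2) Suppose that $F_f$ is integrable on $\mathbb R$. Then $\mu_f$ is absolutely continuous with respect to the Lebesgue measure on $\mathbb R$ and its density $\varphi_f$ is given by $$\varphi_f(\lambda)=\frac{1}{2\pi}\int_{\mathbb R}e^{it\lambda}F_f(t)\,dt.$$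
   Context: Setting. $M$ is a domain of $\mathbb C^n$, $G$ is a Lie group acting transitively on $M$ by holomorphic automorphisms, $\mu_L$ is Lebesgue measure on $M$, and $\mu=\delta\,\mu_L$ is a $G$-invariant measure on $M$ with $\delta>0$ continuous. $K$ is a continuous function on $M$ with $K>0$. $\mathcal H$ is the Hilbert space of all holomorphic functions $f$ on $M$ with $\Vert f\Vert_{\mathcal H}^2=\int_M|f(z)|^2K(z)^{-1}\delta(z)\,d\mu_L(z)<\infty$; it is a reproducing kernel Hilbert space, with coherent states $e_z\in\mathcal H$ satisfying $f(z)=\langle f,e_z\rangle_{\mathcal H}$. There is a function $\alpha:G\times M\to\mathbb C^*$ with $\alpha(g_1g_2,x)=\alpha(g_1,g_2\cdot x)\alpha(g_2,x)$ and $K(g\cdot x)=|\alpha(g,x)|^{-2}K(x)$ such that $(\pi(g)f)(x)=\alpha(g^{-1},x)f(g^{-1}\cdot x)$ defines a unitary representation $\pi$ of $G$ on $\mathcal H$, and $\mu$ is normalized so that $\langle e_x,e_x\rangle_{\mathcal H}=K(x)$ for $x\in M$. Fourier conventions. $\mathcal S(\mathbb R)$ is the Schwartz space and $\mathcal S'(\mathbb R)$ the space of tempered distributions. For $\phi\in\mathcal S(\mathbb R)$, $(\mathcal F\phi)(x)=\int_{\mathbb R}e^{-itx}\phi(t)\,dt$ and $(\mathcal F^{-1}\phi)(t)=\frac1{2\pi}\int_{\mathbb R}e^{itx}\phi(x)\,dx$. For $\nu\in\mathcal S'(\mathbb R)$, $\langle\mathcal F(\nu),\phi\rangle=\langle\nu,\mathcal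 F\phi\rangle$ and $\langle\mathcal F^{-1}(\nu),\phi\rangle=\langle\nu,\mathcal F^{-1}\phi\rangle$. A probability measure $\mu$ and a bounded measurable function $F$ are regarded as tempered distributions by $\langle\mu,\phi\rangle=\int\phi\,d\mu$ and $\langle F,\phi\rangle=\int F(t)\phi(t)\,dt$. *)

(* Defs.v *)
From HB Require Import structures.
From mathcomp Require Import all_boot all_order all_algebra.
From mathcomp Require Import all_classical all_reals all_analysis.
From mathcomp Require Import measurable_realfun complex.
From mathcomp Require Import lra ring.

Set Implicit Arguments.
Unset Strict Implicit.
Unset Printing Implicit Defensive.

Import Order.TTheory GRing.Theory Num.Theory.
Import numFieldNormedType.Exports.

Local Open Scope classical_set_scope.
Local Open Scope ring_scope.
Local Open Scope complex_scope.

HB.instance Definition _ (R : rcfType) := NormedModule.copy R[i] R[i]^o.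

Section power_measure.
Context d (T : measurableType d) (R : realType).
Variable m : {sigma_finite_measure set T -> \bar R}.

Definition tuple_cons n (p : T * n.-tuple T) : n.+1.-tuple T :=
  [tuple of p.1 :: p.2].

Lemma measurable_tuple_cons n : measurable_fun setT (@tuple_cons n).
Proof. exact: (@measurable_cons _ _ _ _ fst n snd). Qed.

Section step.
Variables (n : nat) (m' : {sigma_finite_measure set (n.-tuple T) -> \bar R}).

Definition cons_measure : set (n.+1.-tuple T) -> \bar R :=
  pushforward (m \x m')%E (@tuple_cons n).

HB.instance Definition _ := Measure.copy cons_measure
  (measure_function_pushforward__canonical__measure_function_Measure
     (m \x m')%E (@measurable_tuple_cons n)).

Let cons_measure_sigma_finite : sigma_finite setT cons_measure.
Proof.
have /sigma_finiteP[F [FT ndF Ffin]] := sigma_finiteT m.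
have /sigma_finiteP[G [GT ndG Gfin]] := sigma_finiteT m'.
pose h (t : n.+1.-tuple T) : T * n.-tuple T := (thead t, [tuple of behead t]).
have mh : measurable_fun setT h.
  apply/measurable_fun_pairP; split; last exact: measurable_behead.
  exact: measurable_tnth.
have hK : cancel (@tuple_cons n) h.
  case=> x t; rewrite /h /tuple_cons /=; congr pair; last exact/val_inj.
exists (fun k => h @^-1` (F k `*` G k)).
  apply/esym; rewrite -subTset => t _.
  have [k _ Fk] : (\bigcup_k F k) (h t).1 by rewrite -FT.
  have [l _ Gl] : (\bigcup_k G k) (h t).2 by rewrite -GT.
  exists (maxn k l) => //; split.
    by have /subsetPset := ndF _ _ (leq_maxl k l); apply.
  by have /subsetPset := ndG _ _ (leq_maxr k l); apply.
move=> k; have [mF Fk] := Ffin k; have [mG Gk] := Gfin k.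
split; first by rewrite -[X in measurable X]setTI; apply: mh => //; exact: measurableX.
rewrite /cons_measure /pushforward -comp_preimage.
rewrite (_ : h \o _ = id); last by apply/funext => x /=; rewrite hK.
by rewrite preimage_id product_measure1E// lte_mul_pinfty// ge0_fin_numE.
Qed.

HB.instance Definition _ := Measure_isSigmaFinite.Build _ _ _ cons_measure
  cons_measure_sigma_finite.

End step.

Fixpoint power_measure n : {sigma_finite_measure set (n.-tuple T) -> \bar R} :=
  match n with
  | 0 => \d_[tuple]
  | n'.+1 => cons_measure (power_measure n')
  end.

End power_measure.

Lemma ler_norm_ReIm (R : rcfType) (z : R[i]) :
  `|z| <= (`|complex.Re z| + `|complex.Im z|)%:C.
Proof.
have s0 : 0 <= `|complex.Re z| + `|complex.Im z| by rewrite addr_ge0.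
rewrite normc_def lecR -[leRHS](ger0_norm s0) -[leRHS]sqrtr_sqr ler_sqrt ?sqr_ge0//.
by rewrite sqrrD !real_normK ?num_real// lerD2r lerDl mulrn_wge0//.
Qed.

Section lebesgue_Cn.
Context (R : realType) (n : nat).

Definition borel_Cn := g_sigma_algebraType (open : set_system 'rV[R[i]]_n).

(* (x_1, .., x_n, y_1, .., y_n) |-> (x_1 + i y_1, .., x_n + i y_n) *)
Definition of_real_coords (t : (n + n).-tuple (measurableTypeR R)) : borel_Cn :=
  \row_j (tnth t (lshift n j) +i* tnth t (rshift n j)).

Let box (p : (n + n).-tuple rat * nat) :
    set ((n + n).-tuple (measurableTypeR R)) :=
  [set t | forall j, `|tnth t j - ratr (tnth p.1 j) : R| < p.2.+1%:R^-1].

Let measurable_box p : measurable (box p).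
Proof.
pose J (x : R) : set (measurableTypeR R) :=
  [set` `](x - p.2.+1%:R^-1), (x + p.2.+1%:R^-1)[].
have -> : box p = \bigcap_(j in [set: 'I_(n + n)])
    ((@tnth (n + n) _ ^~ j) @^-1` J (ratr (tnth p.1 j))).
  have JE (x y : R) : (x \in `](y - p.2.+1%:R^-1), (y + p.2.+1%:R^-1)[) =
      (`|x - y| < p.2.+1%:R^-1).
    by rewrite in_itv/= ltr_distl.
  apply/seteqP; split => t /=.
    by move=> H j _; rewrite /J/= JE; exact: H.
  by move=> H j; have := H j I; rewrite /J/= JE.
apply: fin_bigcap_measurable => // j _.
rewrite -[X in measurable X]setTI; apply: measurable_tnth => //.
exact: measurable_itv.
Qed.

Lemma measurable_of_real_coords : measurable_fun setT of_real_coords.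
Proof.
apply: (@measurability _ _ _ borel_Cn setT of_real_coords open) => //.
move=> _ [U oU <-].
rewrite setTI; set V := _ @^-1` _.
have -> : V = \bigcup_(p in [set p | box p `<=` V]) box p.
  apply/seteqP; split => [t Vt|t [p + bt]]; last exact.
  have [e /= e0 Ue] := (nbhs_ballP _ _).1 (open_nbhs_nbhs (conj oU Vt)).
  have [k ke] : exists k : nat, 4 * k.+1%:R^-1 < complex.Re e.
    have re0 : 0 < complex.Re e by case: (e) e0 => a b; rewrite ltcE => /andP[].
    exists (Num.trunc (4 / complex.Re e)).
    by rewrite ltr_pdivrMr// mulrC -ltr_pdivrMr// truncnS_gt.
  set d := k.+1%:R^-1 in ke.
  have d0 : 0 < d by rewrite invr_gt0.
  have [q qP] : {q : R -> rat & forall x, `|x - ratr (q x)| < d}.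
    apply: (@boolp.choice R rat (fun x q => `|x - ratr q| < d)) => x.
    have /rat_in_itvoo[q] : x - d < x + d by rewrite ltrD2l gt0_cp.
    by rewrite in_itv/= => qx; exists q; rewrite distrC ltr_distl.
  exists ([tuple q (tnth t j) | j < n + n], k); last first.
    by move=> j /=; rewrite tnth_mktuple; exact: qP.
  move=> s bs; apply: Ue; split => // i j; rewrite !mxE.
  have close l : `|tnth t l - tnth s l : R| < d + d.
    rewrite (le_lt_trans (ler_distD (ratr (q (tnth t l))) _ _))// ltrD//.
    by rewrite distrC; have := bs l; rewrite /= tnth_mktuple.
  rewrite /ball/= /ball_/=.
  apply: le_lt_trans (ler_norm_ReIm _) _ => /=.
  have -> : e = (complex.Re e)%:C.
    by case: (e) e0 => a b; rewrite ltcE /= => /andP[/eqP -> _].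
  rewrite ltcR (lt_trans _ ke)//.
  have -> : 4 * d = (d + d) + (d + d) :> R.
    by rewrite -!mulr2n -mulrnA mulr_natl.
  exact: ltrD.
rewrite bigcup_mkcond; apply: countable_bigcupT_measurable => // p.
by case: ifP => // _; exact: measurable_box.
Qed.

Definition lebesgue_Cn : set borel_Cn -> \bar R :=
  pushforward (power_measure (@lebesgue_measure R) (n + n)) of_real_coords.

HB.instance Definition _ := Measure.copy lebesgue_Cn
  (measure_function_pushforward__canonical__measure_function_Measure
     (power_measure (@lebesgue_measure R) (n + n)) measurable_of_real_coords).

End lebesgue_Cn.

(* exp(i theta) *)
Definition expi (R : realType) (theta : R) : R[i] := cos theta +i* sin theta.

Definition sqmod (R : realType) (z : R[i]) : R :=
  complex.Re z ^+ 2 + complex.Im z ^+ 2.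

Section complex_integral.
Context d (T : measurableType d) (R : realType).
Variables (mu : {measure set T -> \bar R}) (D : set T).
Implicit Types F G : T -> R[i].

Definition cintegral F : R[i] :=
  (\int[mu]_(x in D) complex.Re (F x)) +i* (\int[mu]_(x in D) complex.Im (F x)).

Definition cintegrable F :=
  mu.-integrable D (fun x => (complex.Re (F x))%:E) /\
  mu.-integrable D (fun x => (complex.Im (F x))%:E).

Hypothesis mD : measurable D.

Lemma cintegralP (a : R[i]) F G : cintegrable F -> cintegrable G ->
  cintegral (fun x => a * F x + G x) = a * cintegral F + cintegral G.
Proof.
case: a => a b [F1 F2] [G1 G2].
have ZF (k : R) (h : T -> R) : mu.-integrable D (fun x => (h x)%:E) ->
    mu.-integrable D (fun x => (k * h x)%:E) by exact: integrableZl.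
have lin (k l : R) (h h' h'' : T -> R) : mu.-integrable D (EFin \o h) ->
    mu.-integrable D (EFin \o h') -> mu.-integrable D (EFin \o h'') ->
    \int[mu]_(x in D) (k * h x + l * h' x + h'' x) =
    k * (\int[mu]_(x in D) h x) + l * (\int[mu]_(x in D) h' x) +
    \int[mu]_(x in D) h'' x.
  move=> ih ih' ih''.
  rewrite RintegralD//; last first.
  have := @integrableD _ _ _ mu _ mD _ _ (ZF k h ih) (ZF l h' ih'). by [].
  by rewrite RintegralD ?RintegralZl//; exact: ZF.
rewrite /cintegral; apply/eqP; rewrite eq_complex /=; apply/andP; split.
  rewrite -mulNr -lin//; apply/eqP/eq_Rintegral => x _.
  by case: (F x) (G x) => ? ? [? ?] /=; rewrite mulNr.
rewrite -lin//; apply/eqP/eq_Rintegral => x _.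
by case: (F x) (G x) => ? ? [? ?] /=.
Qed.

Lemma cintegral_conj F : cintegrable F ->
  cintegral (fun x => (F x)^*%C) = (cintegral F)^*%C.
Proof.
case=> F1 F2; rewrite /cintegral; apply/eqP; rewrite eq_complex /=.
apply/andP; split; first by apply/eqP/eq_Rintegral => x _; case: (F x).
rewrite -mulN1r -RintegralZl//; apply/eqP/eq_Rintegral => x _.
by rewrite mulN1r; case: (F x).
Qed.

End complex_integral.

Lemma continuous_Re (R : realType) : continuous (@complex.Re R).
Proof.
move=> z; apply/(@cvgrPdist_lt R R^o _ (nbhs z) (nbhs_filter z)) => e e0.
apply/nbhs_ballP; exists e%:C; first by rewrite /= ltcR.
move=> w; rewrite /ball /= /ball_ -ltcR; apply: le_lt_trans.
by rewrite -raddfB normc_ge_Re.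
Qed.

Lemma continuous_Im (R : realType) : continuous (@complex.Im R).
Proof.
move=> z; apply/(@cvgrPdist_lt R R^o _ (nbhs z) (nbhs_filter z)) => e e0.
apply/nbhs_ballP; exists e%:C; first by rewrite /= ltcR.
move=> w; rewrite /ball /= /ball_ -ltcR; apply: le_lt_trans.
rewrite -raddfB normc_def lecR -sqrtr_sqr ler_sqrt ?addr_ge0 ?sqr_ge0//.
by rewrite lerDr sqr_ge0.
Qed.

Section measurability_Cn.
Context (R : realType) (n : nat).

Lemma open_measurable_Cn (U : set 'rV[R[i]]_n) :
  open U -> measurable (U : set (borel_Cn R n)).
Proof. exact: sub_sigma_algebra. Qed.

Lemma continuous_measurable_Cn (U : set 'rV[R[i]]_n) (g : 'rV[R[i]]_n -> R) :
  open U -> (forall z, U z -> {for z, continuous g}) ->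
  measurable_fun (U : set (borel_Cn R n)) g.
Proof.
move=> oU cg; apply: (measurability _ (RGenOInfty.measurableE R)).
move=> _ [_ [a ->] <-]; apply: open_measurable_Cn.
rewrite openE => z [Uz ga]; apply: filterI; first exact: open_nbhs_nbhs.
apply: cg => //; apply: open_nbhs_nbhs; split => //; exact: interval_open.
Qed.

End measurability_Cn.

HB.mixin Record Lmodule_isPreHilbert (R : realType) V
    of GRing.Lmodule R[i] V := {
  inner : V -> V -> R[i] ;
  inner_linear : forall (a : R[i]) (u v w : V),
    inner (a *: u + v) w = a * inner u w + inner v w ;
  inner_conj : forall u v : V, inner v u = (inner u v)^*%C ;
  inner_ge0 : forall u : V, 0 <= inner u u
}.

#[short(type="preHilbertType")]
HB.structure Definition PreHilbert (R : realType) :=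
  { V of Lmodule_isPreHilbert R V & GRing.Lmodule R[i] V }.

Section hilbert.
Context (R : realType) (H : preHilbertType R).
Implicit Types u v w : H.

Definition hnorm u : R := Num.sqrt (complex.Re (inner u u)).

Definition hcvg (u_ : nat -> H) v := (fun k => hnorm (u_ k - v)) @ \oo --> (0 : R).

Definition is_hilbert : Prop :=
  (forall u, inner u u = 0 -> u = 0) /\
  (forall u_ : nat -> H,
    (forall e : R, 0 < e -> exists N, forall k l, (N <= k)%N -> (N <= l)%N ->
      hnorm (u_ k - u_ l) < e) ->
    exists v, hcvg u_ v).

End hilbert.

Record weighted_domain (R : realType) (n : nat) := WeightedDomain {
  dom : set 'rV[R[i]]_n ;
  kern : 'rV[R[i]]_n -> R ;
  dens : 'rV[R[i]]_n -> R ;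
  dom_nonempty : dom !=set0 ;
  dom_open : open dom ;
  dom_connected : connected dom ;
  kern_continuous : forall z, dom z -> {for z, continuous kern} ;
  kern_gt0 : forall z, dom z -> 0 < kern z ;
  dens_continuous : forall z, dom z -> {for z, continuous dens} ;
  dens_gt0 : forall z, dom z -> 0 < dens z
}.

Definition holomorphic_on (R : realType) (n : nat) (W : normedModType R[i])
    (U : set 'rV[R[i]]_n) (f : 'rV[R[i]]_n -> W) :=
  forall z, U z -> differentiable f z.

Section holomorphic_L2.
Context (R : realType) (n : nat) (X : weighted_domain R n).
Local Notation Cn := 'rV[R[i]]_n.
Local Notation muL := (@lebesgue_Cn R n).
Local Notation M := (dom X).

Definition dens_measure (B : set (borel_Cn R n)) : \bar R :=
  (\int[muL]_(z in B) (dens X z)%:E)%E.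

Definition weight (z : Cn) : R := (kern X z)^-1 * dens X z.

Definition holL2_pred : {pred Cn -> R[i]} := fun f =>
  `[< [/\ holomorphic_on M f, forall z, ~ M z -> f z = 0 &
      (\int[muL]_(z in M) (sqmod (f z) * weight z)%:E < +oo)%E] >].

Record holL2 := HolL2 { holL2_fun :> Cn -> R[i] ; _ : holL2_fun \in holL2_pred }.

HB.instance Definition _ := [isSub for holL2_fun].
HB.instance Definition _ := [Choice of holL2 by <:].

Let mM : measurable (M : set (borel_Cn R n)).
Proof. by apply: open_measurable_Cn; exact: dom_open. Qed.

Let weight_gt0 z : M z -> 0 < weight z.
Proof. by move=> Mz; rewrite mulr_gt0 ?invr_gt0 ?kern_gt0 ?dens_gt0. Qed.

Let m_weight : measurable_fun (M : set (borel_Cn R n)) weight.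
Proof.
apply: continuous_measurable_Cn => [|z Mz]; first exact: dom_open.
apply: (@continuousM _ _ (fun x => (kern X x)^-1) (dens X)); last exact: dens_continuous.
apply: continuousV; last exact: kern_continuous.
by rewrite gt_eqF// kern_gt0.
Qed.

Let m_Re f : holomorphic_on M f ->
  measurable_fun (M : set (borel_Cn R n)) (fun z => complex.Re (f z)).
Proof.
move=> hf; apply: continuous_measurable_Cn => [|z Mz]; first exact: dom_open.
apply: (@continuous_comp _ _ _ f (@complex.Re R)); last exact: continuous_Re.
by apply: differentiable_continuous; exact: hf.
Qed.

Let m_Im f : holomorphic_on M f ->
  measurable_fun (M : set (borel_Cn R n)) (fun z => complex.Im (f z)).
Proof.
move=> hf; apply: continuous_measurable_Cn => [|z Mz]; first exact: dom_open.
apply: (@continuous_comp _ _ _ f (@complex.Im R)); last exact: continuous_Im.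
by apply: differentiable_continuous; exact: hf.
Qed.

Let m_sqmod f : holomorphic_on M f ->
  measurable_fun (M : set (borel_Cn R n)) (fun z => sqmod (f z) * weight z).
Proof.
move=> hf; apply: measurable_funM => //.
by apply: measurable_funD; apply: measurable_funX; [exact: m_Re|exact: m_Im].
Qed.

Let sqmod_ge0 (z : R[i]) : 0 <= sqmod z.
Proof. by rewrite addr_ge0 ?sqr_ge0. Qed.

Let int_sqmod f : f \in holL2_pred ->
  muL.-integrable M (fun z => (sqmod (f z) * weight z)%:E).
Proof.
move=> /asboolP[hf _ fin]; apply/integrableP; split.
  by apply/measurable_EFinP; exact: m_sqmod.
rewrite (eq_integral (fun z : borel_Cn R n => (sqmod (f z) * weight z)%:E))// => z.
by rewrite inE => Mz; rewrite gee0_abs// lee_fin mulr_ge0 ?sqmod_ge0// ltW// weight_gt0.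
Qed.

Let holL2_submod : submod_closed holL2_pred.
Proof.
split.
  apply/asboolP; split => [z _||] //.
  rewrite (eq_integral (cst 0%E)) ?integral0//= => z _.
  by rewrite /sqmod /= expr0n /= addr0 mul0r.
move=> a f g hf hg; apply/asboolP; have [/asboolP[df f0 _] /asboolP[dg g0 _]] := (hf, hg).
have dafg : holomorphic_on M (a *: f + g).
  move=> z Mz; apply: differentiableD; last exact: dg.
  apply: differentiableZ; exact: df.
split => //.
  by move=> z nMz; rewrite /= -[(a *: f + g) z]/(a * f z + g z) f0// g0// mulr0 addr0.
pose h z := ((2 * sqmod a) * (sqmod (f z) * weight z) + 2 * (sqmod (g z) * weight z))%R.
have ih : muL.-integrable M (fun z => (h z)%:E).
  have := @integrableD _ _ _ muL _ mM _ _
    (integrableZl mM (2 * sqmod a) (int_sqmod hf)) (integrableZl mM 2 (int_sqmod hg)).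
  by [].
have /integrableP[_] : muL.-integrable M
    (fun z => (sqmod ((a *: f + g) z) * weight z)%:E).
  apply: (le_integrable mM _ _ ih).
    by apply/measurable_EFinP; exact: (m_sqmod dafg).
  move=> z Mz; have w0 := weight_gt0 Mz.
  have qw k : 0 <= sqmod k * weight z by rewrite mulr_ge0 ?sqmod_ge0 ?(ltW w0).
  rewrite !abse_EFin lee_fin !ger0_norm; last 2 first.
  - by rewrite /h addr_ge0// mulr_ge0// mulr_ge0.
  - exact: qw.
  rewrite /h; move: (weight z) w0 {qw} => w w0.
  rewrite !mulrA -mulrDl ler_pM2r//.
  rewrite -[(a *: f + g) z]/(a * f z + g z) /sqmod.
  case: (a) (f z) (g z) => a1 a2 [f1 f2] [g1 g2] /=.
  rewrite -subr_ge0.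
  set e := (X in 0 <= X).
  have -> : e = (a1 * f1 - a2 * f2 - g1) ^+ 2 + (a1 * f2 + a2 * f1 - g2) ^+ 2.
    by rewrite /e; ring.
  by rewrite addr_ge0 ?sqr_ge0.
rewrite (eq_integral (fun z : borel_Cn R n =>
  (sqmod ((a *: f + g) z) * weight z)%:E))// => z.
by rewrite inE => Mz; rewrite gee0_abs// lee_fin mulr_ge0 ?sqmod_ge0// ltW// weight_gt0.
Qed.

HB.instance Definition _ :=
  GRing.isSubmodClosed.Build R[i] (Cn -> R[i]) holL2_pred holL2_submod.
HB.instance Definition _ := [SubChoice_isSubLmodule of holL2 by <:].

Lemma holL2_linear (a : R[i]) (f g : holL2) z : (a *: f + g) z = a * f z + g z.
Proof. by []. Qed.

Definition holL2_inner (f g : holL2) : R[i] :=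
  cintegral muL M (fun z => f z * (g z)^*%C * (weight z)%:C).

Let cintegrable_inner (f g : holL2) :
  cintegrable muL M (fun z => f z * (g z)^*%C * (weight z)%:C).
Proof.
have [/asboolP[hf _ _] /asboolP[hg _ _]] := (valP f, valP g).
have ib := integrableD mM (int_sqmod (valP f)) (int_sqmod (valP g)).
have bound (k : Cn -> R) : measurable_fun (M : set (borel_Cn R n)) k ->
    (forall z, `|k z| <= sqmod (f z) + sqmod (g z)) ->
    muL.-integrable M (fun z => (k z * weight z)%:E).
  move=> mk kle; apply: (le_integrable mM _ _ ib).
    by apply/measurable_EFinP; exact: measurable_funM.
  move=> z Mz; have w0 := weight_gt0 Mz.
  rewrite -[leRHS]/(`|(sqmod (f z) * weight z + sqmod (g z) * weight z)%:E|%E).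
  rewrite !abse_EFin lee_fin -mulrDl !normrM ler_pM//.
  by rewrite (le_trans (kle z))// ler_norm.
split.
  rewrite (_ : (fun z => _) = (fun z => (((complex.Re (f z) * complex.Re (g z) +
      complex.Im (f z) * complex.Im (g z))) * weight z)%:E)); last first.
    by apply/funext => z; case: (f z) (g z) => a b [c d] /=; congr EFin; ring.
  apply: (bound (fun z => _ + _)) => [|z].
    by apply: measurable_funD; apply: measurable_funM;
      solve [exact: m_Re | exact: m_Im].
  case: (f z) (g z) => a b [c d]; rewrite /sqmod /= ler_norml.
  have := (sqr_ge0 (a + c), sqr_ge0 (b + d), sqr_ge0 (a - c), sqr_ge0 (b - d)).
  have := (sqr_ge0 a, sqr_ge0 b, sqr_ge0 c, sqr_ge0 d).
  by case=> -[[? ?] ?] ? [[[? ?] ?] ?]; apply/andP; split; nra.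
rewrite (_ : (fun z => _) = (fun z => (((complex.Im (f z) * complex.Re (g z) -
    complex.Re (f z) * complex.Im (g z))) * weight z)%:E)); last first.
  by apply/funext => z; case: (f z) (g z) => a b [c d] /=; congr EFin; ring.
apply: (bound (fun z => _ - _)) => [|z].
  by apply: measurable_funB; apply: measurable_funM;
    solve [exact: m_Re | exact: m_Im].
case: (f z) (g z) => a b [c d]; rewrite /sqmod /= ler_norml.
have := (sqr_ge0 (b + c), sqr_ge0 (a - d), sqr_ge0 (b - c), sqr_ge0 (a + d)).
have := (sqr_ge0 a, sqr_ge0 b, sqr_ge0 c, sqr_ge0 d).
by case=> -[[? ?] ?] ? [[[? ?] ?] ?]; apply/andP; split; nra.
Qed.

Let inner_linear (a : R[i]) (f g h : holL2) :
  holL2_inner (a *: f + g) h = a * holL2_inner f h + holL2_inner g h.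
Proof.
rewrite /holL2_inner -(cintegralP mM a (cintegrable_inner f h)
  (cintegrable_inner g h)).
congr cintegral; apply/funext => z.
by rewrite holL2_linear !mulrDl !mulrA.
Qed.

Let inner_conj (f g : holL2) : holL2_inner g f = (holL2_inner f g)^*%C.
Proof.
rewrite /holL2_inner -(cintegral_conj mM (cintegrable_inner f g)).
congr cintegral; apply/funext => z.
case: (f z) (g z) => a b [c d]; apply/eqP; rewrite eq_complex /=.
by apply/andP; split; apply/eqP; ring.
Qed.

Let inner_ge0 (f : holL2) : 0 <= holL2_inner f f.
Proof.
rewrite /holL2_inner /cintegral lecE /=; apply/andP; split.
  rewrite (_ : (fun z => _) = cst 0).
    by rewrite /Rintegral integral0.
  by apply/funext => z; case: (f z) => a b /=; ring.
apply: Rintegral_ge0 => z Mz; have := weight_gt0 Mz.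
case: (f z) => a b /=; move: (weight z) => w w0.
by rewrite !mulr0 !subr0 mulrN opprK mulr_ge0 ?(ltW w0)// addr_ge0// -expr2 sqr_ge0.
Qed.

HB.instance Definition _ := Lmodule_isPreHilbert.Build R holL2
  inner_linear inner_conj inner_ge0.

End holomorphic_L2.

Section spectral_family.
Context (R : realType) (H : preHilbertType R).

Record spectral_family := SpectralFamily {
  resol :> R -> H -> H ;
  resol_linear : forall (l : R) (a : R[i]) (u v : H),
    resol l (a *: u + v) = a *: resol l u + resol l v ;
  resol_symmetric : forall (l : R) (u v : H),
    inner (resol l u) v = inner u (resol l v) ;
  resol_min : forall (l m : R) (u : H),
    resol l (resol m u) = resol (Num.min l m) u ;
  resol_right_continuous : forall (l : R) (u : H),
    (fun m => hnorm (resol m u - resol l u)) @ l^'+ --> (0 : R) ;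
  resol_ninfty : forall u : H, (fun m => hnorm (resol m u)) @ -oo --> (0 : R) ;
  resol_pinfty : forall u : H,
    (fun m => hnorm (resol m u - u)) @ +oo --> (0 : R)
}.

Definition spectral_cdf (E : spectral_family) (u : H) (l : R) : R :=
  complex.Re (inner (E l u) u).

Variables (E : spectral_family) (u : H).

Let innerBl (v w z : H) : inner (v - w) z = inner v z - inner w z.
Proof. by rewrite addrC -scaleN1r inner_linear mulN1r addrC. Qed.

Let hnorm_sqr (v : H) : hnorm v ^+ 2 = complex.Re (inner v v).
Proof. by rewrite sqr_sqrtr//; have := inner_ge0 v; rewrite lecE => /andP[]. Qed.

Let spectral_cdfB l m : l <= m ->
  spectral_cdf E u m = spectral_cdf E u l + hnorm (E m u - E l u) ^+ 2.
Proof.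
move=> lm; rewrite hnorm_sqr.
have EB k v w : E k (v - w) = E k v - E k w.
  by rewrite addrC -scaleN1r resol_linear scaleN1r addrC.
have Emm : E m (E m u - E l u) = E m u - E l u.
  by rewrite EB !resol_min minxx (min_idPr lm).
have Elm : E l (E m u - E l u) = 0.
  by rewrite EB !resol_min minxx (min_idPl lm) subrr.
have inner0 (v : H) : inner v 0 = 0.
  by have := innerBl v v v; rewrite !subrr => i0; rewrite inner_conj i0 rmorph0.
rewrite [X in complex.Re X](_ : _ = inner u (E m u - E l u)).
  rewrite inner_conj innerBl /spectral_cdf.
  by case: (inner _ u) (inner _ u) => a b [c d] /=; rewrite addrC subrK.
by rewrite innerBl !resol_symmetric Emm Elm inner0 subr0.
Qed.

Let spectral_cdf_nd : nondecreasing (spectral_cdf E u).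
Proof. by move=> l m lm; rewrite (spectral_cdfB lm) lerDl sqr_ge0. Qed.

Let spectral_cdf_rc : right_continuous (spectral_cdf E u).
Proof.
move=> l.
have : (fun m => spectral_cdf E u l + hnorm (E m u - E l u) ^+ 2) @ l^'+ -->
    spectral_cdf E u l + 0 * 0.
  apply: cvgD; first exact: cvg_cst.
  by apply: cvgM; exact: resol_right_continuous.
rewrite mul0r addr0; apply: cvg_trans; apply: near_eq_cvg.
near=> m; rewrite (@spectral_cdfB l m)//.
Unshelve. all: by end_near. Qed.

HB.instance Definition _ :=
  isCumulative.Build R _ R (spectral_cdf E u) spectral_cdf_nd spectral_cdf_rc.

Definition spectral_measure : set (measurableTypeR R) -> \bar R :=
  lebesgue_stieltjes_measure (spectral_cdf E u).
HB.instance Definition _ := Measure.on spectral_measure.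
End spectral_family.

(* Lie groups. *)
#[short(type="topGroupType")]
HB.structure Definition TopGroup := { G of Group G & Topological G }.

Section smooth.
Context (R : realType).

Fixpoint Ck (k : nat) (V W : normedModType R) (U : set V) (f : V -> W) : Prop :=
  match k with
  | 0 => forall x, U x -> {for x, continuous f}
  | k'.+1 => (forall x, U x -> differentiable f x) /\
             forall v, Ck k' U (fun x => 'D_v f x)
  end.

Definition smooth_on (V W : normedModType R) (U : set V) (f : V -> W) :=
  forall k, Ck k U f.

Record chart (d : nat) (G : topologicalType) := Chart {
  chart_dom : set G ;
  chart_map : G -> 'rV[R]_d ;
  chart_inv : 'rV[R]_d -> G ;
  chart_dom_open : open chart_dom ;
  chart_img_open : open (chart_map @` chart_dom) ;
  chart_map_continuous :
    forall x, chart_dom x -> {for x, continuous chart_map} ;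
  chart_inv_continuous :
    forall y, (chart_map @` chart_dom) y -> {for y, continuous chart_inv} ;
  chart_mapK : forall x, chart_dom x -> chart_inv (chart_map x) = x
}.

Definition chart_img d (G : topologicalType) (a : chart d G) :=
  chart_map a @` chart_dom a.

Record lie_structure (d : nat) (G : topGroupType) := LieStructure {
  atlas : set (chart d G) ;
  lie_hausdorff : hausdorff_space G ;
  lie_second_countable : @second_countable G ;
  atlas_cover : forall x : G, exists2 a, atlas a & chart_dom a x ;
  atlas_compatible : forall a b, atlas a -> atlas b ->
    smooth_on (chart_map a @` (chart_dom a `&` chart_dom b))
      (chart_map b \o chart_inv a) ;
  lie_mul_continuous : continuous (fun p : G * G => (p.1 * p.2)%g) ;
  lie_inv_continuous : continuous (fun x : G => x^-1%g) ;
  lie_mul_smooth : forall a b c, atlas a -> atlas b -> atlas c ->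
    smooth_on [set p : 'rV[R]_d * 'rV[R]_d |
        [/\ chart_img a p.1, chart_img b p.2 &
            chart_dom c (chart_inv a p.1 * chart_inv b p.2)%g]]
      (fun p => chart_map c (chart_inv a p.1 * chart_inv b p.2)%g) ;
  lie_inv_smooth : forall a b, atlas a -> atlas b ->
    smooth_on [set x | chart_img a x /\ chart_dom b (chart_inv a x)^-1%g]
      (fun x => chart_map b (chart_inv a x)^-1%g)
}.

End smooth.

Section holomorphic_action.
Context (R : realType) (n d : nat).
Local Notation Cn := 'rV[R[i]]_n.

Definition of_ReIm (p : 'rV[R]_n * 'rV[R]_n) : Cn :=
  \row_j (p.1 0 j +i* p.2 0 j).

Definition to_ReIm (z : Cn) : 'rV[R]_n * 'rV[R]_n :=
  (\row_j complex.Re (z 0 j), \row_j complex.Im (z 0 j)).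

Definition transitive_holomorphic_action (G : topGroupType)
    (L : lie_structure R d G) (M : set Cn) (act : G -> Cn -> Cn) :=
  [/\ (forall g z, M z -> M (act g z)) /\
      (forall g, holomorphic_on M (act g)),
      forall z, M z -> act 1%g z = z,
      forall g h z, M z -> act (g * h)%g z = act g (act h z),
      forall a, atlas L a ->
        smooth_on [set p : 'rV[R]_d * ('rV[R]_n * 'rV[R]_n) |
            chart_img a p.1 /\ M (of_ReIm p.2)]
          (fun p => to_ReIm (act (chart_inv a p.1) (of_ReIm p.2)))
    & forall z w, M z -> M w -> exists g, act g z = w].

End holomorphic_action.

(* Unbounded operators and the functional calculus. *)
Section operators.
Context (R : realType) (H : preHilbertType R).

(* Only the restriction of [op_fun] to [op_dom] is meaningful. *)
Record operator := Operator {
  op_dom : set H ;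
  op_fun :> H -> H ;
  op_dom0 : op_dom 0 ;
  op_domP : forall (a : R[i]) (u v : H),
    op_dom u -> op_dom v -> op_dom (a *: u + v) ;
  op_linear : forall (a : R[i]) (u v : H),
    op_dom u -> op_dom v -> op_fun (a *: u + v) = a *: op_fun u + op_fun v
}.

Definition densely_defined (A : operator) :=
  forall (u : H) (e : R), 0 < e -> exists2 v, op_dom A v & hnorm (u - v) < e.

(* the graph of the adjoint of [A] *)
Definition adjoint_graph (A : operator) (v w : H) :=
  forall u, op_dom A u -> inner (A u) v = inner u w.

Definition self_adjoint (A : operator) :=
  densely_defined A /\
  forall v w, adjoint_graph A v w <-> op_dom A v /\ A v = w.

(* The list [:: (c_1, (a_1, b_1)); ... ; (c_N, (a_N, b_N))] stands for the step
   function \sum_j c_j 1_{]a_j, b_j]}, whose integral against dE is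
   \sum_j c_j (E_{b_j} - E_{a_j}). *)
Definition step_ok (s : seq (R[i] * (R * R))) :=
  all (fun p => p.2.1 <= p.2.2) s.

Definition step_fun (s : seq (R[i] * (R * R))) (x : R) : R[i] :=
  \sum_(p <- s) p.1 * (\1_(`]p.2.1, p.2.2]%classic) x)%:C.

Definition step_integral (E : spectral_family H) (s : seq (R[i] * (R * R)))
  (u : H) : H := \sum_(p <- s) p.1 *: (E p.2.2 u - E p.2.1 u).

(* v = \int h(l) dE_l u: v is the limit of the integrals of step functions
   converging to h in L^2(d<E_l u, u>). *)
Definition spectral_integral (E : spectral_family H) (h : R -> R[i]) (u v : H) :=
  exists s : nat -> seq (R[i] * (R * R)),
    [/\ forall k, step_ok (s k),
        (fun k => \int[spectral_measure E u]_x
                    (sqmod (h x - step_fun (s k) x))%:E)%E @ \oo --> 0%E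
      & hcvg (fun k => step_integral E (s k) u) v].

(* A = \int l dE_l *)
Definition spectral_decomposition (A : operator) (E : spectral_family H) :=
  (forall u, op_dom A u <->
     (\int[spectral_measure E u]_x ((x : R) ^+ 2)%:E < +oo)%E) /\
  (forall u, op_dom A u -> spectral_integral E (fun l => l%:C) u (A u)).

(* exp(-itA) = \int exp(-itl) dE_l for A = \int l dE_l; the integral is the
   unique such vector when H is a Hilbert space. *)
Definition exp_mitA (E : spectral_family H) (t : R) (u : H) : H :=
  xget 0 [set v | spectral_integral E (fun l => expi (- (t * l))) u v].

Definition unitary_representation (G : topGroupType) (pi : G -> H -> H) :=
  [/\ forall g (a : R[i]) u v, pi g (a *: u + v) = a *: pi g u + pi g v,
      forall g u v, inner (pi g u) (pi g v) = inner u v,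
      forall u, pi 1%g u = u,
      forall g h u, pi (g * h)%g u = pi g (pi h u)
    & forall u g0, (fun g => hnorm (pi g u - pi g0 u)) @ g0 --> (0 : R)].

End operators.

(* Tempered distributions on the real line. *)
Section tempered.
Context (R : realType).
Local Notation leb := (@lebesgue_measure R).

Definition cderiv (k : nat) (phi : R -> R[i]) (x : R) : R[i] :=
  derive1n k (fun y => complex.Re (phi y)) x +i* derive1n k (fun y => complex.Im (phi y)) x.

Definition schwartz (phi : R -> R[i]) :=
  (forall k x, derivable (derive1n k (fun y => complex.Re (phi y))) x 1 /\
               derivable (derive1n k (fun y => complex.Im (phi y))) x 1) /\
  (forall m k, exists B : R, forall x : R,
     (`|x| ^+ m)%:C * `|cderiv k phi x| <= B%:C).

(* [tempered T]: the restriction of T to the Schwartz space is linear and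
   continuous for the usual seminorms, i.e., it is an element of S'(R). *)
Definition tempered (T : (R -> R[i]) -> R[i]) :=
  (forall (a : R[i]) phi psi, schwartz phi -> schwartz psi ->
     T (fun x => a * phi x + psi x) = a * T phi + T psi) /\
  (exists (N : nat) (C : R), forall phi (B : R), schwartz phi ->
     (forall m k, (m <= N)%N -> (k <= N)%N -> forall x : R,
        (`|x| ^+ m)%:C * `|cderiv k phi x| <= B%:C) ->
     `|T phi| <= (C * B)%:C).

(* equality in S'(R) *)
Definition eq_tempered (T1 T2 : (R -> R[i]) -> R[i]) :=
  [/\ tempered T1, tempered T2 & forall phi, schwartz phi -> T1 phi = T2 phi].

Definition distr_measure (mu : {measure set (measurableTypeR R) -> \bar R})
  (phi : R -> R[i]) : R[i] := cintegral mu setT phi.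

Definition distr_fun (F : R -> R[i]) (phi : R -> R[i]) : R[i] :=
  cintegral leb setT (fun t : R => F t * phi t).

Definition fourier_inv (phi : R -> R[i]) (t : R) : R[i] :=
  ((2 * pi)^-1)%:C * cintegral leb setT (fun x : R => expi (t * x) * phi x).

Definition distr_fourier_inv (T : (R -> R[i]) -> R[i]) (phi : R -> R[i]) : R[i] :=
  T (fourier_inv phi).

Definition has_density (mu : {measure set (measurableTypeR R) -> \bar R})
    (phi : R -> R[i]) :=
  cintegrable leb setT phi /\
  forall S : set (measurableTypeR R), measurable S ->
    mu S = (complex.Re (cintegral leb S phi))%:E /\
    complex.Im (cintegral leb S phi) = 0.

End tempered.

(* Main.v *)
Require Import Defs.
From HB Require Import structures.
From mathcomp Require Import all_boot all_order all_algebra.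
From mathcomp Require Import all_classical all_reals all_analysis.
From mathcomp Require Import measurable_realfun complex.
From mathcomp Require Import lra ring.

Set Implicit Arguments.
Unset Strict Implicit.
Unset Printing Implicit Defensive.

Import Order.TTheory GRing.Theory Num.Theory.
Import numFieldNormedType.Exports.

Local Open Scope classical_set_scope.
Local Open Scope ring_scope.
Local Open Scope complex_scope.

(** Write mu for the spectral measure of a unit vector f. Everything rests on
    the identity

      <exp(-itA) f, f> = \int exp(-itl) dmu(l),

    that is, F_f is the Fourier transform of mu; what remains is classical
    Fourier inversion for a finite measure on the real line.

    The identity ([inner_exp_mitA]) comes from the isometry between step
    functions in L^2(mu) and their integrals against the spectral family
    ([hnorm_step]), which follows from E_l E_m = E_(min l m). By completeness
    the integrals of step functions approximating exp(-itl) converge, so that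
    exp(-itA) f is a genuine spectral integral ([spectral_integral_exists],
    [sq_error_approx]); its inner product with f is then the limit of the
    integrals of the step functions ([inner_spectral_integral]).

    Fourier inversion is proved by Abel summation. The factor exp(-e|t|) has
    the Poisson kernel e / (pi (e^2 + y^2)) as its Fourier transform, up to the
    factor 2 pi ([cintegral_abel_expi]). By Fubini, inserting this factor in the
    inverse Fourier integral of F_f gives the Poisson mean of mu, the
    convolution of mu with the Poisson kernel ([cintegral_abel_charfun]). As e
    tends to 0, Poisson means converge to mu when tested against bounded
    continuous functions ([poisson_mean_cvg]), because the Poisson kernel is an
    approximate identity.

    (1) For a Schwartz function phi, the Poisson means of mu tested against phi
    equal the integral of exp(-e|t|) F_f(t) (F^-1 phi)(t) dt
    ([poisson_mean_fourier]). Letting e tend to 0 on both sides gives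
    [fourier_inversion]; on the right this is dominated convergence, available
    since two integrations by parts show that F^-1 phi decays like 1/(1+t^2)
    ([fourier_inv_decay]). The same decay bound makes the distributions
    defined by F_f tempered.

    (2) If F_f is integrable, dominated convergence shows that the Poisson means
    converge pointwise and boundedly to the inverse Fourier integral of F_f,
    which is therefore real and nonnegative ([poisson_mean_cvg_density]).
    Comparing with the weak limit identifies its integral against continuous
    test functions, then over half-open intervals through trapezoids
    ([itvoc_density]), and finally over all Borel sets because such intervals
    generate them ([measure_density]). *)

(** * Complex-valued integrals *)

Local Notation normc := (@ComplexField.Normc.normc _).

Section modulus.
Context (R : realType).
Implicit Types z w : R[i].

Lemma normcE z : normc z = Num.sqrt (sqmod z).
Proof. by case: z. Qed.

Lemma normr_normc z : `|z| = (normc z)%:C.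
Proof. by []. Qed.

Lemma normc_ge0 z : 0 <= normc z.
Proof. by rewrite normcE sqrtr_ge0. Qed.

Lemma normcM z w : normc (z * w) = normc z * normc w.
Proof. exact: ComplexField.Normc.normcM. Qed.

Lemma le_normcD z w : normc (z + w) <= normc z + normc w.
Proof. by rewrite -lecR rmorphD -!normr_normc ler_normD. Qed.

Lemma normc_real (x : R) : normc x%:C = `|x|.
Proof. by rewrite normcE /sqmod /= expr0n /= addr0 sqrtr_sqr. Qed.

Lemma normc_expi (x : R) : normc (expi x) = 1.
Proof. by rewrite normcE /sqmod /= cos2Dsin2 sqrtr1. Qed.

Lemma Re_le_normc z : `|complex.Re z| <= normc z.
Proof.
rewrite normcE -sqrtr_sqr ler_sqrt ?addr_ge0 ?sqr_ge0//.
by rewrite /sqmod lerDl sqr_ge0.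
Qed.

Lemma Im_le_normc z : `|complex.Im z| <= normc z.
Proof.
rewrite normcE -sqrtr_sqr ler_sqrt ?addr_ge0 ?sqr_ge0//.
by rewrite /sqmod lerDr sqr_ge0.
Qed.

Lemma normc_le_ReIm z : normc z <= `|complex.Re z| + `|complex.Im z|.
Proof. by rewrite -lecR -normr_normc ler_norm_ReIm. Qed.

Lemma expiD (x y : R) : expi (x + y) = expi x * expi y.
Proof.
by apply/eqP; rewrite eq_complex /= cosD sinD; apply/andP; split; apply/eqP; ring.
Qed.

Lemma sqmod_ge0 z : 0 <= sqmod z.
Proof. by rewrite addr_ge0 ?sqr_ge0. Qed.

Lemma sqmodN z : sqmod (- z) = sqmod z.
Proof. by case: z => a b; rewrite /sqmod /= !sqrrN. Qed.

Lemma sqmodD_le z w : sqmod (z + w) <= 2 * sqmod z + 2 * sqmod w.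
Proof.
case: z w => a b [c d]; rewrite /sqmod /=.
by have := (sqr_ge0 (a - c), sqr_ge0 (b - d)); case => ? ?; nra.
Qed.

(** Stated in the complex field, where it can be rewritten in inner products. *)
Lemma sqmod_conj z : (sqmod z)%:C = z * z^*%C.
Proof.
by case: z => a b; apply/eqP; rewrite eq_complex /sqmod /=; apply/andP; split; apply/eqP;
  ring.
Qed.

Lemma sqmodE z : sqmod z = normc z ^+ 2.
Proof. by rewrite normcE sqr_sqrtr// sqmod_ge0. Qed.

Lemma normcN z : normc (- z) = normc z.
Proof. by rewrite !normcE sqmodN. Qed.

Lemma normc_conj z : normc (z^*%C) = normc z.
Proof. by case: z => a b; rewrite !normcE /sqmod /= sqrrN. Qed.

End modulus.

Section complex_integration.
Context d (T : measurableType d) (R : realType).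
Implicit Types (D : set T) (F G : T -> R[i]) (g h : T -> R).

(** The real and imaginary parts are kept apart because [cintegral] and
    [cintegrable] are defined through them. *)
Definition cmeasurable D F :=
  measurable_fun D (fun x => complex.Re (F x)) /\
  measurable_fun D (fun x => complex.Im (F x)).

Lemma cmeasurableM D F G : cmeasurable D F -> cmeasurable D G ->
  cmeasurable D (fun x => F x * G x).
Proof.
move=> [F1 F2] [G1 G2]; split.
  rewrite (_ : (fun x => _) = (fun x => complex.Re (F x) * complex.Re (G x) -
    complex.Im (F x) * complex.Im (G x))).
    by apply: measurable_funB; exact: measurable_funM.
  by apply/funext => x; case: (F x) (G x) => ? ? [].
rewrite (_ : (fun x => _) = (fun x => complex.Re (F x) * complex.Im (G x) +
  complex.Im (F x) * complex.Re (G x))).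
  by apply: measurable_funD; exact: measurable_funM.
by apply/funext => x; case: (F x) (G x) => ? ? [].
Qed.

Lemma cmeasurableD D F G :
  cmeasurable D F -> cmeasurable D G -> cmeasurable D (fun x => F x + G x).
Proof.
move=> [F1 F2] [G1 G2]; split.
  rewrite (_ : (fun x => _) = (fun x => complex.Re (F x) + complex.Re (G x))).
    exact: measurable_funD.
  by apply/funext => x; rewrite raddfD.
rewrite (_ : (fun x => _) = (fun x => complex.Im (F x) + complex.Im (G x))).
  exact: measurable_funD.
by apply/funext => x; rewrite raddfD.
Qed.

Lemma cmeasurable_real D g : measurable_fun D g ->
  cmeasurable D (fun x => (g x)%:C).
Proof. by move=> mg; split => //=; exact: measurable_cst. Qed.

Lemma cmeasurable_cst D (z : R[i]) : cmeasurable D (fun=> z).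
Proof. by split; exact: measurable_cst. Qed.

Lemma cmeasurableN D F :
  cmeasurable D F -> cmeasurable D (fun x => - F x).
Proof.
move=> mF; rewrite (_ : (fun x => - F x) = (fun x => (-1) * F x)).
  by apply: cmeasurableM => //; exact: cmeasurable_cst.
by apply/funext => x; rewrite mulN1r.
Qed.

Lemma cmeasurable_conj D F :
  cmeasurable D F -> cmeasurable D (fun x => (F x)^*%C).
Proof.
move=> [F1 F2]; split.
  by rewrite (_ : (fun x => _) = (fun x => complex.Re (F x)))//; apply/funext => x;
    case: (F x).
rewrite (_ : (fun x => _) = (fun x => - complex.Im (F x))).
  exact: measurableT_comp.
by apply/funext => x; case: (F x).
Qed.

Lemma cmeasurable_expi D g : measurable_fun D g ->
  cmeasurable D (fun x => expi (g x)).
Proof.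
move=> mg; split => /=.
  apply: measurableT_comp mg; apply: continuous_measurable_fun.
  exact: continuous_cos.
apply: measurableT_comp mg; apply: continuous_measurable_fun.
exact: continuous_sin.
Qed.

Variable mu : {measure set T -> \bar R}.

Lemma integrable_bound D h g : measurable D -> measurable_fun D h ->
  mu.-integrable D (EFin \o g) -> (forall x, D x -> `|h x| <= g x) ->
  mu.-integrable D (EFin \o h).
Proof.
move=> mD mh ig hg; apply: (le_integrable mD _ _ ig).
  exact/measurable_EFinP.
by move=> x Dx /=; rewrite lee_fin (le_trans (hg _ Dx))// ler_norm.
Qed.

Lemma EFin_Rintegral D h : measurable D -> mu.-integrable D (EFin \o h) ->
  (\int[mu]_(x in D) h x)%:E = (\int[mu]_(x in D) (h x)%:E)%E.
Proof. by move=> mD ih; rewrite fineK//; exact: integrable_fin_num. Qed.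

Lemma integrable_scalel D (k : R) h : measurable D ->
  mu.-integrable D (EFin \o h) ->
  mu.-integrable D (EFin \o (fun x => k * h x)).
Proof. by move=> mD ih; exact: (@integrableZl _ _ _ mu D mD k _ ih). Qed.

Lemma integrable_scaler D (k : R) h : measurable D ->
  mu.-integrable D (EFin \o h) ->
  mu.-integrable D (EFin \o (fun x => h x * k)).
Proof. by move=> mD ih; exact: (@integrableZr _ _ _ mu D mD k _ ih). Qed.

Lemma normr_Rintegral_le D h g : measurable D -> measurable_fun D h ->
  mu.-integrable D (EFin \o g) -> (forall x, D x -> `|h x| <= g x) ->
  `|\int[mu]_(x in D) h x| <= \int[mu]_(x in D) g x.
Proof.
move=> mD mh ig hg; have ih := integrable_bound mD mh ig hg.
apply: (le_trans (le_normr_Rintegral mD ih)).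
by apply: le_Rintegral => //; exact: integrable_norm.
Qed.

Lemma cintegrable_bound D F g : measurable D -> cmeasurable D F ->
  mu.-integrable D (EFin \o g) -> (forall x, D x -> normc (F x) <= g x) ->
  cintegrable mu D F.
Proof.
move=> mD [F1 F2] ig Fg; split.
  by apply: (integrable_bound mD F1 ig) => x /Fg; apply: le_trans; exact: Re_le_normc.
by apply: (integrable_bound mD F2 ig) => x /Fg; apply: le_trans; exact: Im_le_normc.
Qed.

(** The factor 2 comes from bounding the two parts separately. *)
Lemma normc_cintegral_le D F g : measurable D -> cmeasurable D F ->
  mu.-integrable D (EFin \o g) -> (forall x, D x -> normc (F x) <= g x) ->
  normc (cintegral mu D F) <= 2 * \int[mu]_(x in D) g x.
Proof.
move=> mD [F1 F2] ig Fg; rewrite (le_trans (normc_le_ReIm _))//=.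
rewrite mulr_natl mulr2n lerD//; apply: normr_Rintegral_le => // x /Fg; apply: le_trans.
  exact: Re_le_normc.
exact: Im_le_normc.
Qed.

Lemma cintegralZ D (a : R[i]) F : measurable D -> cintegrable mu D F ->
  cintegral mu D (fun x => a * F x) = a * cintegral mu D F.
Proof.
move=> mD iF; have i0 : cintegrable mu D (fun=> 0).
  by split; exact: integrable0.
have := cintegralP mD a iF i0.
have -> : cintegral mu D (fun=> 0) = 0.
  by rewrite /cintegral /= /Rintegral !integral0.
by rewrite addr0 => <-; congr cintegral; apply/funext => x; rewrite addr0.
Qed.

End complex_integration.

Section dominated_convergence.
Context (R : realType).

Lemma Re_cintegral_real d (T : measurableType d) (mu : {measure set T -> \bar R})
    (a : T -> R) (F : T -> R[i]) :
  complex.Re (cintegral mu setT (fun t => (a t)%:C * F t)) =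
  \int[mu]_t (a t * complex.Re (F t)).
Proof. by apply: eq_Rintegral => t _; case: (F t) => x y /=; rewrite mul0r subr0. Qed.

Lemma Im_cintegral_real d (T : measurableType d) (mu : {measure set T -> \bar R})
    (a : T -> R) (F : T -> R[i]) :
  complex.Im (cintegral mu setT (fun t => (a t)%:C * F t)) =
  \int[mu]_t (a t * complex.Im (F t)).
Proof. by apply: eq_Rintegral => t _; case: (F t) => x y /=; rewrite mul0r addr0. Qed.

Lemma Rintegral_dominated_cvg d (T : measurableType d)
    (mu : {measure set T -> \bar R}) (f_ : nat -> T -> R) (f g : T -> R) :
  (forall n, measurable_fun setT (f_ n)) ->
  (forall x, f_ ^~ x @ \oo --> f x) ->
  mu.-integrable setT (EFin \o g) -> (forall n x, `|f_ n x| <= g x) ->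
  (fun n => \int[mu]_x f_ n x) @ \oo --> \int[mu]_x f x.
Proof.
move=> mf cf ig fg.
have mfl : measurable_fun setT f by apply: (measurable_fun_cvg mf) => x _; exact: cf.
have lfg x : `|f x| <= g x.
  have cn : (fun n => `|f_ n x|) @ \oo --> `|f x| by apply: cvg_norm; exact: cf.
  by apply: (cvgr_to_le cn); exact: nearW.
apply: fine_cvg; rewrite fineK; last first.
  by apply: integrable_fin_num => //; exact: (integrable_bound _ mfl ig).
apply: (@dominated_cvg _ _ _ mu setT measurableT _ _ (EFin \o g)) => //.
- by move=> n; exact/measurable_EFinP.
- by move=> x _; apply: cvg_EFin; [exact: nearW|exact: cf].
- by move=> n x _ /=; rewrite lee_fin.
Qed.

End dominated_convergence.

Section fubini.
Context d1 d2 (T1 : measurableType d1) (T2 : measurableType d2) (R : realType).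
Variable m1 : {sigma_finite_measure set T1 -> \bar R}.
Variable m2 : {sigma_finite_measure set T2 -> \bar R}.
Variables (g1 : T1 -> R) (g2 : T2 -> R).
Hypothesis ig1 : m1.-integrable setT (EFin \o g1).
Hypothesis ig2 : m2.-integrable setT (EFin \o g2).

(** A dominating function that splits as a product makes every section
    integrable, not just almost every one, so that real-valued iterated integrals
    can be exchanged without exceptional sets. *)
Lemma Rintegral_swap (f : T1 * T2 -> R) : measurable_fun setT f ->
  (forall x y, `|f (x, y)| <= g1 x * g2 y) ->
  m1.-integrable setT (fun x => (\int[m2]_y f (x, y))%:E) /\
  \int[m1]_x (\int[m2]_y f (x, y)) = \int[m2]_y (\int[m1]_x f (x, y)).
Proof.
move=> mf fg.
have mg1 : measurable_fun setT g1.
  by apply/measurable_EFinP; exact: measurable_int ig1.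
have mg2 : measurable_fun setT g2.
  by apply/measurable_EFinP; exact: measurable_int ig2.
have mn1 : measurable_fun setT (fun x => `|g1 x|) by exact: measurableT_comp.
have mn2 : measurable_fun setT (fun x => `|g2 x|) by exact: measurableT_comp.
have mf1 x : measurable_fun setT (fun y => f (x, y)).
  exact: measurableT_comp mf (measurable_pair1 _).
have mf2 y : measurable_fun setT (fun x => f (x, y)).
  exact: measurableT_comp mf (measurable_pair2 _).
have i2 x : m2.-integrable setT (fun y => (f (x, y))%:E).
  apply: (@integrable_bound _ _ _ _ _ _ (fun y => g1 x * g2 y)) => //.
  exact: integrable_scalel.
have i1 y : m1.-integrable setT (fun x => (f (x, y))%:E).
  apply: (@integrable_bound _ _ _ _ _ _ (fun x => g1 x * g2 y)) => //.
  exact: integrable_scaler.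
have mfE : measurable_fun setT (EFin \o f) by exact/measurable_EFinP.
have mabs : measurable_fun setT (abse \o (EFin \o f)) by exact: measurableT_comp.
have imf : (m1 \x m2)%E.-integrable setT (EFin \o f).
  apply/integrable12ltyP => //.
  pose C := \int[m2]_y `|g2 y|.
  have iabs2 := integrable_norm ig2.
  apply: (@le_lt_trans _ _ (\int[m1]_x (`|g1 x| * C)%:E)%E).
    apply: ge0_le_integral => //.
    - by move=> x _; exact: integral_ge0.
    - by apply: (measurable_fun_fubini_tonelli_F (abse \o (EFin \o f))) => //= ?;
      rewrite lee_fin.
    - by apply/measurable_EFinP/measurable_funM.
    - move=> x _; rewrite -RintegralZl// EFin_Rintegral//; last first.
        exact: integrable_scalel.
      apply: ge0_le_integral => //.
      + by apply/measurable_EFinP/measurableT_comp.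
      + by apply/measurable_EFinP/measurable_funM.
      + by move=> y _ /=; rewrite lee_fin -normrM (le_trans (fg x y))// ler_norm.
  have : m1.-integrable setT (fun x => (`|g1 x| * C)%:E).
    by apply: integrable_scaler => //; exact: integrable_norm ig1.
  move=> /integrableP[_]; apply: le_lt_trans; apply: ge0_le_integral => //.
  - by move=> x _; rewrite lee_fin mulr_ge0// Rintegral_ge0.
  - by apply/measurable_EFinP/measurable_funM.
  - by apply: measurableT_comp => //; apply/measurable_EFinP/measurable_funM.
  - by move=> x _; rewrite lee_fin ler_norm.
have E1 : (fun x => (\int[m2]_y f (x, y))%:E) = (fun x => \int[m2]_y (EFin \o f) (x, y))%E.
  by apply/funext => x; exact: (EFin_Rintegral _ (i2 x)).
have E2 : (fun y => (\int[m1]_x f (x, y))%:E) = (fun y => \int[m1]_x (EFin \o f) (x, y))%E.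
  by apply/funext => y; exact: (EFin_Rintegral _ (i1 y)).
split; first by rewrite E1; exact: (integrable_fubini_F imf).
by rewrite /Rintegral E1 E2 (Fubini imf).
Qed.

Lemma cintegral_swap (F : T1 * T2 -> R[i]) : cmeasurable setT F ->
  (forall x y, normc (F (x, y)) <= g1 x * g2 y) ->
  cintegrable m1 setT (fun x => cintegral m2 setT (fun y => F (x, y))) /\
  cintegral m1 setT (fun x => cintegral m2 setT (fun y => F (x, y))) =
  cintegral m2 setT (fun y => cintegral m1 setT (fun x => F (x, y))).
Proof.
move=> [F1 F2] Fg.
have [i1 s1] := Rintegral_swap F1 (fun x y => le_trans (Re_le_normc _) (Fg x y)).
have [i2 s2] := Rintegral_swap F2 (fun x y => le_trans (Im_le_normc _) (Fg x y)).
by split => //; rewrite /cintegral; congr (_ +i* _).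
Qed.

End fubini.

(** * The Abel factor and the Poisson kernel *)

Section kernels.
Context (R : realType).
Local Notation leb := (@lebesgue_measure R).
Implicit Types e t x y : R.

Lemma integrableT_ge0 (g : R -> R) (r : R) : measurable_fun setT g ->
  (forall x, 0 <= g x) -> (\int[leb]_x (g x)%:E)%E = r%:E ->
  leb.-integrable setT (EFin \o g).
Proof.
move=> mg g0 gr; apply/integrableP; split; first exact/measurable_EFinP.
under eq_integral do rewrite /= ger0_norm//.
by rewrite gr ltry.
Qed.

Lemma ge0_integralT_half (h : R -> R) : continuous h -> (forall x, 0 <= h x) ->
  (\int[leb]_x (h x)%:E = \int[leb]_(x in `[0%R, +oo[) (h x)%:E +
    \int[leb]_(x in `[0%R, +oo[) (h (- x))%:E)%E.
Proof.
move=> ch h0; have mh : measurable_fun setT h by exact: continuous_measurable_fun.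
rewrite -(setUv `[0, +oo[%classic) ge0_integral_setU//=; last 4 first.
- exact: measurableC.
- by apply/measurable_EFinP; rewrite setUv.
- by move=> x _; rewrite lee_fin.
- exact/disj_setPCl.
congr (_ + _)%E; rewrite setCitvr.
rewrite integral_itv_bndo_bndc; last exact/measurable_EFinP/measurable_funTS.
rewrite -{1}oppr0 ge0_integration_by_substitutionNy//.
exact: continuous_subspaceT.
Qed.

(** Applied to exp(-e|t|)(1 + sin(ty)), reflection shows that the sine part of
    the Fourier integral of exp(-e|t|) vanishes. *)
Lemma ge0_integralT_opp (h : R -> R) : continuous h -> (forall x, 0 <= h x) ->
  (\int[leb]_x (h (- x))%:E = \int[leb]_x (h x)%:E)%E.
Proof.
move=> ch h0; rewrite (ge0_integralT_half ch)// addeC (@ge0_integralT_half (h \o -%R))/=;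
  last 2 first.
- by move=> x; apply: continuous_comp; [exact: opp_continuous|exact: ch].
- by move=> x; exact: h0.
by congr (_ + _)%E; apply: eq_integral => x _; rewrite opprK.
Qed.

Definition abel e t := expR (- (e * `|t|)).

Definition poisson e y := e / (pi * (e ^+ 2 + y ^+ 2)).

Lemma abel_ge0 e t : 0 <= abel e t. Proof. exact: expR_ge0. Qed.

Lemma abel_le1 e t : 0 <= e -> abel e t <= 1.
Proof. by move=> e0; rewrite -expR0 ler_expR oppr_le0 mulr_ge0. Qed.

Lemma continuous_abel e : continuous (abel e).
Proof.
move=> t; apply: continuous_comp; last exact: continuous_expR.
apply: cvgN; apply: cvgM; first exact: cvg_cst.
exact: norm_continuous.
Qed.

Lemma poisson_den_gt0 e y : 0 < e -> 0 < pi * (e ^+ 2 + y ^+ 2).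
Proof. by move=> e0; rewrite mulr_gt0 ?pi_gt0// ltr_pwDl ?sqr_ge0// exprn_gt0. Qed.

Lemma poisson_ge0 e y : 0 < e -> 0 <= poisson e y.
Proof. by move=> e0; rewrite divr_ge0 ?(ltW e0)// ltW// poisson_den_gt0. Qed.

Lemma continuous_poisson e : 0 < e -> continuous (poisson e).
Proof.
move=> e0 y; apply: cvgM; first exact: cvg_cst.
apply: cvgV; first by rewrite gt_eqF// poisson_den_gt0.
apply: cvgM; first exact: cvg_cst.
apply: cvgD; first exact: cvg_cst.
exact: exprn_continuous.
Qed.

(** The primitive of the kernel is atan / pi. *)
Lemma integral_poisson1 : (\int[leb]_x (poisson 1 x)%:E = 1%:E)%E.
Proof.
rewrite ge0_integralT_half//; last 2 first.
- exact: continuous_poisson ltr01.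
- by move=> x; exact: poisson_ge0 ltr01.
have -> : (\int[leb]_(x in `[0%R, +oo[) (poisson 1 (- x))%:E =
    \int[leb]_(x in `[0%R, +oo[) (poisson 1 x)%:E)%E.
  by apply: eq_integral => x _; rewrite /poisson sqrrN.
have dF x : is_derive x 1 (fun x => pi^-1 * atan x) (poisson 1 x).
  rewrite /poisson expr1n invfM mul1r.
  exact: is_deriveZ.
rewrite (@ge0_continuous_FTC2y _ (poisson 1) (fun x => pi^-1 * atan x) 0 (pi^-1 * (pi /
  2))).
- rewrite atan0 mulr0 sube0 -EFinD; congr EFin.
  by have := lt0r_neq0 (pi_gt0 R); move: pi => p p0; field.
- by move=> x _; exact: poisson_ge0 ltr01.
- by apply: continuous_subspaceT; exact: continuous_poisson ltr01.
- by apply: cvgM; [exact: cvg_cst|exact: cvgy_atan].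
- by move=> x _; have [] := dF x.
- apply: cvg_at_right_filter; apply: cvgM; first exact: cvg_cst.
  exact: continuous_atan.
- by move=> x _; rewrite derive1E; have [] := dF x.
Qed.

(** Adding 1 to the cosine makes the integrand nonnegative, so that the
    fundamental theorem of calculus on a half-line applies. *)
Lemma integral_abel_cos e y : 0 < e ->
  (\int[leb]_t (abel e t * (1 + cos (t * y)))%:E =
   (2 * (e^-1 + e / (e ^+ 2 + y ^+ 2)))%:E)%E.
Proof.
move=> e0; have D0 : e ^+ 2 + y ^+ 2 != 0.
  by rewrite gt_eqF// ltr_pwDl ?sqr_ge0// exprn_gt0.
have c0 t : 0 <= 1 + cos (t * y) by have := cos_geN1 (t * y); lra.
have cf : continuous (fun t => abel e t * (1 + cos (t * y))).
  move=> t; apply: cvgM; first exact: continuous_abel.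
  apply: cvgD; first exact: cvg_cst.
  apply: continuous_comp; last exact: continuous_cos.
  by apply: cvgM; [exact: cvg_id|exact: cvg_cst].
rewrite ge0_integralT_half//; last by move=> t; rewrite mulr_ge0 ?abel_ge0.
have -> : (\int[leb]_(t in `[0%R, +oo[) (abel e (- t) * (1 + cos (- t * y)))%:E =
    \int[leb]_(t in `[0%R, +oo[) (abel e t * (1 + cos (t * y)))%:E)%E.
  by apply: eq_integral => x _; rewrite /abel normrN mulNr cosN.
(* A primitive of the integrand on the half-line where |t| = t. *)
pose F t := expR (- (e * t)) *
  (- e^-1 + (y * sin (t * y) - e * cos (t * y)) / (e ^+ 2 + y ^+ 2)).
have dF t : is_derive t 1 F (expR (- (e * t)) * (1 + cos (t * y))).
  have de : is_derive t 1 (fun t => expR (- (e * t))) (expR (- (e * t)) * - e).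
    apply: (@is_derive1_comp _ expR (fun t => - (e * t))).
    by apply: is_deriveN; apply: is_derive_eq; rewrite /GRing.scale /= mulr1.
  have dy : is_derive t 1 (fun t => t * y) y.
    by apply: is_derive_eq; rewrite /GRing.scale /= mulr0 add0r mulr1.
  have ds : is_derive t 1 (fun t => sin (t * y)) (cos (t * y) * y).
    exact: (@is_derive1_comp _ sin (fun t => t * y)).
  have dc : is_derive t 1 (fun t => cos (t * y)) (- sin (t * y) * y).
    exact: (@is_derive1_comp _ cos (fun t => t * y)).
  rewrite /F; apply: is_derive_eq; rewrite /GRing.scale /=.
  set E := expR _; set C := cos _; set S := sin _.
  by field; rewrite D0 gt_eqF.
rewrite (@ge0_continuous_FTC2y _ _ F 0 0).
- rewrite /F !(mulr0, mul0r, oppr0) expR0 cos0 sin0 -!EFinB -EFinD; congr EFin.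
  by field; rewrite D0 gt_eqF.
- by move=> x _; rewrite mulr_ge0 ?abel_ge0.
- exact: continuous_subspaceT.
- pose C := e^-1 + (`|y| + e) / (e ^+ 2 + y ^+ 2).
  have FC t : `|F t| <= expR (- (e * t)) * C.
    rewrite normrM ger0_norm ?expR_ge0// ler_wpM2l ?expR_ge0//.
    rewrite (le_trans (ler_normD _ _))// lerD//; first by rewrite normrN normfV gtr0_norm.
    rewrite normrM normfV [`|_ ^+ 2 + _|]ger0_norm ?addr_ge0 ?sqr_ge0//.
    rewrite ler_wpM2r ?invr_ge0 ?addr_ge0 ?sqr_ge0//.
    rewrite (le_trans (ler_normB _ _))// lerD// normrM ?[`|e|]gtr0_norm//.
      by rewrite ler_piMr// ler_norml sin_geN1 sin_le1.
    by rewrite ler_piMr ?(ltW e0)// ler_norml cos_geN1 cos_le1.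
  have E0 : expR (- (e * t)) * C @[t --> +oo] --> 0.
    rewrite -[0](mul0r C); apply: cvgM; last exact: cvg_cst.
    apply: (cvg_comp (fun t => e * t) (fun t => expR (- t))); last exact: cvgr_expR.
    by apply: gt0_cvgMry => //; exact: cvg_id.
  apply: (@squeeze_cvgr _ _ _ _ (fun t => - (expR (- (e * t)) * C)) _ _ _ _ _ E0).
    by near=> t; rewrite -ler_norml FC.
  by rewrite -oppr0; exact: cvgN.
- by move=> x _; have [] := dF x.
- apply: cvg_at_right_filter; apply: differentiable_continuous.
  by apply/derivable1_diffP; have [] := dF 0.
- move=> x; rewrite in_itv/= andbT => x0; rewrite derive1E; have [_ ->] := dF x.
  by rewrite /abel gtr0_norm.
Unshelve. all: by end_near. Qed.

Lemma Rintegral_abel e : 0 < e ->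
  leb.-integrable setT (EFin \o abel e) /\ \int[leb]_t abel e t = 2 / e.
Proof.
move=> e0; have := integral_abel_cos 0 e0.
under eq_integral do rewrite mulr0 cos0.
move=> E2; have i2 : leb.-integrable setT (EFin \o (fun t => abel e t * (1 + 1))).
  apply: integrableT_ge0 E2; last by move=> t; rewrite mulr_ge0 ?abel_ge0.
  by apply: continuous_measurable_fun => t; apply: cvgM;
    [exact: continuous_abel|exact: cvg_cst].
have i1 : leb.-integrable setT (EFin \o abel e).
  apply: eq_integrable (integrable_scaler 2^-1 _ i2) => // t _ /=.
  by congr EFin; rewrite -[1 + 1]/(2%:R) mulfK ?pnatr_eq0.
split => //; apply: (@mulIf _ (2 : R)); first by rewrite pnatr_eq0.
rewrite -(RintegralZr 2 _ i1)// /Rintegral E2 /=.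
have en0 : e != 0 by rewrite gt_eqF.
by field.
Qed.

Lemma integrable_abel e : 0 < e -> leb.-integrable setT (EFin \o abel e).
Proof. by move=> /Rintegral_abel[]. Qed.

(** The Fourier transform of exp(-e|t|): the cosine part is
    [integral_abel_cos] minus half its value for y = 0, the sine part is odd. *)
Lemma cintegral_abel_expi e y : 0 < e ->
  cintegral leb setT (fun t => (abel e t)%:C * expi (t * y)) =
  (2 * pi * poisson e y)%:C.
Proof.
move=> e0; have [ia Ia] := Rintegral_abel e0.
have ma : measurable_fun setT (abel e).
  by apply: continuous_measurable_fun; exact: continuous_abel.
have ib (h : R -> R) : continuous h -> (forall t, `|h t| <= 1) ->
    leb.-integrable setT (EFin \o (fun t => abel e t * h t)).
  move=> ch h1; apply: (integrable_bound _ _ ia) => //.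
    by apply: measurable_funM => //; exact: continuous_measurable_fun.
  by move=> t _; rewrite normrM ger0_norm ?abel_ge0// ler_piMr ?abel_ge0.
have cy : continuous (fun t => t * y).
  by move=> t; apply: cvgM; [exact: cvg_id|exact: cvg_cst].
have cc : continuous (fun t => cos (t * y)).
  by move=> t; apply: continuous_comp; [exact: cy|exact: continuous_cos].
have cs : continuous (fun t => sin (t * y)).
  by move=> t; apply: continuous_comp; [exact: cy|exact: continuous_sin].
have icos : leb.-integrable setT (EFin \o (fun t => abel e t * cos (t * y))).
  by apply: ib => // t; rewrite ler_norml cos_geN1 cos_le1.
have isin : leb.-integrable setT (EFin \o (fun t => abel e t * sin (t * y))).
  by apply: ib => // t; rewrite ler_norml sin_geN1 sin_le1.
apply/eqP; rewrite eq_complex /=; apply/andP; split; apply/eqP.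
  under eq_Rintegral do rewrite mul0r subr0.
  apply: (addrI (\int[leb]_t abel e t)); rewrite -RintegralD//.
  under eq_Rintegral do rewrite -[X in X + _]mulr1 -mulrDr.
  rewrite /Rintegral integral_abel_cos//= -/(\int[leb]_t abel e t) Ia /poisson.
  have p0 := lt0r_neq0 (pi_gt0 R); have := lt0r_neq0 (poisson_den_gt0 y e0).
  rewrite mulf_eq0 negb_or => /andP[_ D0]; have en0 : e != 0 by rewrite gt_eqF.
  by move: pi p0 => p p0; field; rewrite p0 D0.
under eq_Rintegral do rewrite mul0r addr0.
have := @ge0_integralT_opp (fun t => abel e t * (1 + sin (t * y))).
have -> : (fun t => (abel e (- t) * (1 + sin (- t * y)))%:E) =
    (fun t => (abel e t - abel e t * sin (t * y))%:E).
  by apply/funext => t; rewrite /abel normrN mulNr sinN mulrBr mulr1.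
have -> : (fun t => (abel e t * (1 + sin (t * y)))%:E) =
    (fun t => (abel e t + abel e t * sin (t * y))%:E).
  by apply/funext => t; rewrite mulrDr mulr1.
move=> /(_ _ _)/(congr1 fine); rewrite -!/(Rintegral _ _ _) RintegralB// RintegralD//.
set I := \int[leb]_t (_ * _) => H.
suff: - I = I by lra.
apply: (addrI (\int[leb]_t abel e t)); apply: H.
  by move=> t; apply: cvgM; [exact: continuous_abel|apply: cvgD;
    [exact: cvg_cst|exact: cs]].
by move=> t; rewrite mulr_ge0 ?abel_ge0//; have := sin_geN1 (t * y); lra.
Qed.

Lemma poisson_le e x : 0 < e -> poisson e x <= (pi * e)^-1.
Proof.
move=> e0; have p0 := pi_gt0 R.
rewrite /poisson ler_pdivrMr ?poisson_den_gt0//.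
have -> : (pi * e)^-1 * (pi * (e ^+ 2 + x ^+ 2)) = e + e^-1 * x ^+ 2.
  by have := lt0r_neq0 p0; have := lt0r_neq0 e0; move: pi => p ? ?; field; apply/andP.
by rewrite lerDl mulr_ge0 ?sqr_ge0// invr_ge0 ltW.
Qed.

Lemma integrable_poisson1 : leb.-integrable setT (EFin \o poisson 1).
Proof.
apply: (integrableT_ge0 _ _ integral_poisson1) => [|x].
  by apply: continuous_measurable_fun; exact: continuous_poisson ltr01.
exact: poisson_ge0 ltr01.
Qed.

End kernels.

(** * Poisson means of a finite measure *)

Section finite_measure_integrals.
Context (R : realType).
Variable mu : {finite_measure set (measurableTypeR R) -> \bar R}.
Local Notation mass := (fine (mu setT)).

Lemma integrable_cst (k : R) : mu.-integrable setT (EFin \o cst k).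
Proof. exact: finite_measure_integrable_cst. Qed.

Lemma Rintegral_cstT (k : R) : \int[mu]_l k = k * mass.
Proof. by rewrite Rintegral_cst. Qed.

Lemma cintegrable_bounded (F : R -> R[i]) (M : R) :
  cmeasurable (setT : set (measurableTypeR R)) F -> (forall x, normc (F x) <= M) ->
  cintegrable mu setT F.
Proof.
by move=> mF bF; apply: (cintegrable_bound measurableT mF (integrable_cst M)) => x _.
Qed.

Lemma measurable_sqmod (F : R -> R[i]) :
  cmeasurable (setT : set (measurableTypeR R)) F ->
  measurable_fun (setT : set (measurableTypeR R)) (fun x => sqmod (F x)).
Proof. by move=> [F1 F2]; apply: measurable_funD; exact: measurable_funX. Qed.

Lemma integrable_sqmod (F : R -> R[i]) (B : R) :
  cmeasurable (setT : set (measurableTypeR R)) F -> (forall x, normc (F x) <= B) ->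
  mu.-integrable setT (EFin \o (fun x => sqmod (F x))).
Proof.
move=> mF bF.
apply: (integrable_bound measurableT (measurable_sqmod mF) (integrable_cst (B ^+ 2))) =>
  x _.
by rewrite ger0_norm ?sqmod_ge0// sqmodE lerXn2r ?nnegrE ?normc_ge0// (le_trans
  (normc_ge0 _) (bF x)).
Qed.

(** The variance of a with respect to a probability measure is nonnegative. *)
Lemma sqr_Rintegral_le (a : R -> R) (B : R) : mass = 1 ->
  measurable_fun (setT : set (measurableTypeR R)) a -> (forall x, `|a x| <= B) ->
  mu.-integrable setT (EFin \o (fun x => a x ^+ 2)) /\
  (\int[mu]_x a x) ^+ 2 <= \int[mu]_x (a x ^+ 2).
Proof.
move=> muT ma ba.
have ia := integrable_bound measurableT ma (integrable_cst B) (fun x _ => ba x).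
have ia2 : mu.-integrable setT (EFin \o (fun x => a x ^+ 2)).
  apply: (integrable_bound measurableT _ (integrable_cst (B ^+ 2))) => [|x _].
    exact: measurable_funX.
  by rewrite normrX lerXn2r ?nnegrE// (le_trans (normr_ge0 _) (ba x)).
split => //; set m := \int[mu]_x a x.
have i2m := integrable_scalel (2 * m) measurableT ia.
have : 0 <= \int[mu]_x (a x - m) ^+ 2 by apply: Rintegral_ge0 => x _; exact: sqr_ge0.
rewrite (_ : \int[mu]_x _ = \int[mu]_x (a x ^+ 2 - 2 * m * a x + m ^+ 2)); last first.
  by apply: eq_Rintegral => x _; ring.
rewrite RintegralD//; [|exact: integrableB ia2 i2m|exact: integrable_cst].
by rewrite RintegralB// RintegralZl// Rintegral_cstT muT -/m; nra.
Qed.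

Lemma sqmod_cintegral_le (F : R -> R[i]) (B : R) : mass = 1 ->
  cmeasurable (setT : set (measurableTypeR R)) F -> (forall x, normc (F x) <= B) ->
  sqmod (cintegral mu setT F) <= \int[mu]_x sqmod (F x).
Proof.
move=> u1 mF bF.
have [m1 m2] := mF.
have [i1 l1] := sqr_Rintegral_le u1 m1 (fun x => le_trans (Re_le_normc _) (bF x)).
have [i2 l2] := sqr_Rintegral_le u1 m2 (fun x => le_trans (Im_le_normc _) (bF x)).
by rewrite {2}/sqmod RintegralD// lerD.
Qed.

End finite_measure_integrals.

Section smoothing.
Context (R : realType).
Local Notation leb := (@lebesgue_measure R).
Variable mu : {finite_measure set (measurableTypeR R) -> \bar R}.
Local Notation mass := (fine (mu setT)).
Implicit Types e t x y l : R.

(** The sign in the exponent is the one of exp(-itA); this is the complex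
    conjugate of the characteristic function of probability theory. *)
Definition charfun t : R[i] := cintegral mu setT (fun l => expi (- (t * l))).

(** The convolution of mu with the Poisson kernel. *)
Definition poisson_mean e x : R := \int[mu]_l poisson e (x - l).

Lemma cmeasurable_expiNM t :
  cmeasurable setT (fun l : measurableTypeR R => expi (- (t * l))).
Proof.
apply: cmeasurable_expi; apply: measurableT_comp; first exact: oppr_measurable.
by apply: measurable_funM; [exact: measurable_cst|exact: measurable_id].
Qed.

Lemma cintegrable_expi t : cintegrable mu setT (fun l => expi (- (t * l))).
Proof.
apply: (cintegrable_bound _ (cmeasurable_expiNM t) (integrable_cst mu 1)) => //.
by move=> l _; rewrite normc_expi.
Qed.

Lemma normc_charfun t : normc (charfun t) <= 2 * mass.
Proof.
rewrite -[mass]mul1r -Rintegral_cstT.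
apply: (normc_cintegral_le _ (cmeasurable_expiNM t) (integrable_cst mu 1)) => //.
by move=> l _; rewrite normc_expi.
Qed.

Lemma cmeasurable_charfun : cmeasurable setT charfun.
Proof.
have cont (h : R -> R) : continuous h -> (forall x, `|h x| <= 1) ->
    continuous (fun t => \int[mu]_l h (- (t * l))).
  move=> ch h1 t.
  have := @continuity_under_integral _ _ _ mu (fun t l => h (- (t * l))) setT
    measurableT (t - 1) (t + 1) _ _ (cst 1) (integrable_cst mu 1) _.
  apply => //.
  - move=> s _; apply: (integrable_bound _ _ (integrable_cst mu 1)) => //.
    apply: measurableT_comp; first exact: continuous_measurable_fun.
    apply: measurableT_comp; first exact: oppr_measurable.
    by apply: measurable_funM; [exact: measurable_cst|exact: measurable_id].
  - apply: aeW => l _ s _; apply: continuous_comp; last exact: ch.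
    by apply: cvgN; apply: cvgM; [exact: cvg_id|exact: cvg_cst].
  - by move=> s _; apply: aeW => l _; exact: h1.
  - by rewrite inE /= in_itv/= ltrBlDr ltrDl ltr01.
split; apply: continuous_measurable_fun => /=; apply: cont.
- exact: continuous_cos.
- by move=> x; rewrite ler_norml cos_geN1 cos_le1.
- exact: continuous_sin.
- by move=> x; rewrite ler_norml sin_geN1 sin_le1.
Qed.

Lemma measurable_poissonB e x : 0 < e ->
  measurable_fun setT (fun l : measurableTypeR R => poisson e (x - l)).
Proof.
move=> e0; apply: measurableT_comp.
  by apply: continuous_measurable_fun; exact: continuous_poisson.
by apply: measurable_funB; [exact: measurable_cst|exact: measurable_id].
Qed.

Lemma integrable_poissonB e x : 0 < e ->
  mu.-integrable setT (EFin \o (fun l => poisson e (x - l))).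
Proof.
move=> e0; apply: (integrable_bound _ _ (integrable_cst mu (pi * e)^-1)) => //.
  exact: measurable_poissonB.
by move=> l _; rewrite ger0_norm ?poisson_ge0// poisson_le.
Qed.

Lemma poisson_mean_ge0 e x : 0 < e -> 0 <= poisson_mean e x.
Proof. by move=> e0; apply: Rintegral_ge0 => l _; exact: poisson_ge0. Qed.

(** Fubini moves the Fourier integral inside the integral defining [charfun],
    where it becomes the Fourier transform of exp(-e|t|) at x - l. *)
Lemma cintegral_abel_charfun e x : 0 < e ->
  cintegral leb setT (fun t => (abel e t)%:C * (expi (t * x) * charfun t)) =
  (2 * pi * poisson_mean e x)%:C.
Proof.
move=> e0.
pose F (p : measurableTypeR R * measurableTypeR R) : R[i] :=
  (abel e p.1)%:C * expi (p.1 * (x - p.2)).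
have mF : cmeasurable setT F.
  apply: cmeasurableM.
    apply: cmeasurable_real; apply: measurableT_comp measurable_fst.
    by apply: continuous_measurable_fun; exact: continuous_abel.
  apply: cmeasurable_expi; apply: measurable_funM; first exact: measurable_fst.
  by apply: measurable_funB; [exact: measurable_cst|exact: measurable_snd].
have bF t l : normc (F (t, l)) <= abel e t * cst 1 l.
  by rewrite normcM normc_expi normc_real ger0_norm ?abel_ge0.
have [_ sw] := cintegral_swap (integrable_abel e0) (integrable_cst mu 1) mF bF.
transitivity (cintegral leb setT (fun t => cintegral mu setT (fun l => F (t, l)))).
  congr cintegral; apply/funext => t; rewrite mulrA -cintegralZ//;
    last exact: cintegrable_expi.
  congr cintegral; apply/funext => l; rewrite -mulrA -expiD; congr (_ * expi _).
  by rewrite /= mulrBr.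
rewrite sw; under eq_fun do rewrite /F/= cintegral_abel_expi//.
apply/eqP; rewrite eq_complex /=; apply/andP; split; apply/eqP.
  by rewrite RintegralZl//; exact: integrable_poissonB.
by rewrite Rintegral_cstT mul0r.
Qed.

Lemma cmeasurable_abel_charfun e x : cmeasurable (setT : set (measurableTypeR R))
  (fun t => (abel e t)%:C * (expi (t * x) * charfun t)).
Proof.
apply: cmeasurableM.
  by apply: cmeasurable_real; apply: continuous_measurable_fun; exact: continuous_abel.
apply: cmeasurableM; last exact: cmeasurable_charfun.
by apply: cmeasurable_expi; apply: measurable_funM;
  [exact: measurable_id|exact: measurable_cst].
Qed.

Lemma cintegrable_abel_charfun e x : 0 < e ->
  cintegrable leb setT (fun t => (abel e t)%:C * (expi (t * x) * charfun t)).
Proof.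
move=> e0; have iM := integrable_scaler (2 * mass) measurableT (integrable_abel e0).
apply: (cintegrable_bound measurableT (cmeasurable_abel_charfun e x) iM) => t _.
rewrite !normcM normc_real normc_expi mul1r ger0_norm ?abel_ge0//.
by rewrite ler_wpM2l ?abel_ge0// normc_charfun.
Qed.

Lemma EFin_psmooth e x : 0 < e ->
  ((poisson_mean e x)%:E = \int[mu]_l (poisson e (x - l))%:E)%E.
Proof. by move=> e0; rewrite EFin_Rintegral//; exact: integrable_poissonB. Qed.

Lemma measurable_poisson_prod e : 0 < e ->
  measurable_fun setT
   (fun p : measurableTypeR R * measurableTypeR R => poisson e (p.1 - p.2)).
Proof.
move=> e0; apply: measurableT_comp.
  by apply: continuous_measurable_fun; exact: continuous_poisson.
by apply: measurable_funB; [exact: measurable_fst|exact: measurable_snd].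
Qed.

Lemma measurable_psmooth e : 0 < e -> measurable_fun setT (poisson_mean e).
Proof.
move=> e0; apply/measurable_EFinP.
rewrite (_ : _ \o _ = (fun x => \int[mu]_l (poisson e (x - l))%:E)%E); last first.
  by apply/funext => x; exact: EFin_psmooth.
apply: (measurable_fun_fubini_tonelli_F (fun p : measurableTypeR R * measurableTypeR R =>
  (poisson e (p.1 - p.2))%:E)).
  by apply/measurable_EFinP; exact: measurable_poisson_prod.
by move=> p; rewrite lee_fin poisson_ge0.
Qed.

Section weak_limit.
Variables (g : R -> R) (B : R).
Hypotheses (cg : continuous g) (g0 : forall x, 0 <= g x) (gB : forall x, g x <= B).

Let mg : measurable_fun setT g.
Proof. exact: continuous_measurable_fun. Qed.

(** The substitution x = l + e y turns all kernels into the single function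
    [poisson 1], so that e tends to 0 inside g only. *)
Lemma poisson_subst e l : 0 < e ->
  (\int[leb]_x (g x * poisson e (x - l))%:E =
   \int[leb]_y (g (l + e * y) * poisson 1 y)%:E)%E.
Proof.
move=> e0; pose S y := l + e * y.
have dS y : is_derive y 1 S e.
  by rewrite /S; apply: is_derive_eq; rewrite /GRing.scale /= add0r mul1r mulr1.
have S'E : derive1 S = cst e by apply/funext => y; rewrite derive1E; have [] := dS y.
have cG : continuous (fun x : R => g x * poisson e (x - l)).
  move=> x; apply: cvgM; first exact: cg.
  apply: (@continuous_comp _ _ _ (fun x : R => x - l) (poisson e));
    last exact: continuous_poisson.
  by apply: cvgB; [exact: cvg_id|exact: cvg_cst].
rewrite (@increasing_ge0_integration_by_substitutionT _ S)//.
- apply: eq_integral => y _; rewrite [derive1 _]S'E; congr EFin.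
  rewrite -[LHS]/(g (S y) * poisson e (S y - l) * e) -mulrA; congr (_ * _).
  rewrite /S [l + _]addrC addrK /poisson.
  have p0 := lt0r_neq0 (pi_gt0 R); have := lt0r_neq0 (poisson_den_gt0 (e * y) e0).
  have := lt0r_neq0 (poisson_den_gt0 y (@ltr01 R)).
  rewrite !mulf_eq0 !negb_or => /andP[_ D1] /andP[_ D0].
  have en0 : e != 0 by rewrite gt_eqF.
  by move: pi p0 => p p0; rewrite expr1n in D1 *; field; exact/and3P.
- by move=> x y xy; rewrite /S ltrD2l ltr_pM2l.
- by rewrite S'E; exact: cst_continuous.
- by rewrite S'E; exact: is_cvg_cst.
- by rewrite S'E; exact: is_cvg_cst.
- apply/cvgrNyPle => A; near=> y.
  rewrite /S -lerBrDl -ler_pdivlMl//; near: y; exact: nbhs_ninfty_le.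
- apply/cvgryPge => A; near=> y.
  rewrite /S -lerBlDl -ler_pdivrMl//; near: y; exact: nbhs_pinfty_ge.
- by move=> x; rewrite mulr_ge0 ?poisson_ge0.
Unshelve. all: by end_near. Qed.

Lemma integral_psmooth e : 0 < e ->
  (\int[leb]_x (g x * poisson_mean e x)%:E =
   \int[mu]_l \int[leb]_y (g (l + e * y) * poisson 1 y)%:E)%E.
Proof.
move=> e0.
transitivity (\int[leb]_x \int[mu]_l (g x * poisson e (x - l))%:E)%E.
  apply: eq_integral => x _; rewrite -RintegralZl ?EFin_Rintegral//.
    by apply: integrable_scalel => //; exact: integrable_poissonB.
  exact: integrable_poissonB.
pose f (p : measurableTypeR R * measurableTypeR R) := (g p.1 * poisson e (p.1 - p.2))%:E.
rewrite (@fubini_tonelli _ _ _ _ _ leb mu f)/=.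
- by apply: eq_integral => l _; exact: poisson_subst.
- apply/measurable_EFinP; apply: measurable_funM; last exact: measurable_poisson_prod.
  by apply: measurableT_comp; [exact: mg|exact: measurable_fst].
- by move=> p; rewrite lee_fin mulr_ge0 ?poisson_ge0.
Qed.

(** Dominated convergence twice, first in y for fixed l and then in l, since
    g (l + e y) tends to g l and g is bounded. Nonnegativity of g is what lets
    Tonelli and the substitution be used in the extended reals. *)
Lemma poisson_mean_cvg_ge0 :
  ((fun n => \int[leb]_x (g x * poisson_mean (harmonic n) x)%:E) @ \oo -->
   \int[mu]_l (g l)%:E)%E.
Proof.
under eq_fun do rewrite integral_psmooth ?harmonic_gt0//.
have P0 y : 0 <= poisson 1 y := poisson_ge0 y ltr01.
have iBP := integrable_scalel B measurableT (@integrable_poisson1 R).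
have Qb n l : (0 <= \int[leb]_y (g (l + harmonic n * y) * poisson 1 y)%:E <= B%:E)%E.
  apply/andP; split; first by apply: integral_ge0 => y _; rewrite lee_fin mulr_ge0.
  apply: (@le_trans _ _ (\int[leb]_y (B * poisson 1 y)%:E)%E).
    apply: ge0_le_integral => //.
    - by move=> y _; rewrite lee_fin mulr_ge0.
    - apply/measurable_EFinP/measurable_funM; last first.
        by apply: continuous_measurable_fun; exact: continuous_poisson ltr01.
      apply: measurableT_comp; first exact: mg.
      apply: measurable_funD; first exact: measurable_cst.
      by apply: measurable_funM; [exact: measurable_cst|exact: measurable_id].
    - by apply: measurable_int iBP.
    - by move=> y _; rewrite lee_fin ler_wpM2r.
  rewrite -EFin_Rintegral// RintegralZl//; last exact: integrable_poisson1.
  by rewrite /Rintegral integral_poisson1 mulr1.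
apply: (@dominated_cvg _ _ _ mu setT measurableT _ _ (cst B%:E)).
- move=> n; pose f (p : measurableTypeR R * measurableTypeR R) :=
    (g (p.1 + harmonic n * p.2) * poisson 1 p.2)%:E.
  apply: (@measurable_fun_fubini_tonelli_F _ _ _ _ _ leb f).
    apply/measurable_EFinP; apply: measurable_funM; last first.
      apply: measurableT_comp measurable_snd.
      by apply: continuous_measurable_fun; exact: continuous_poisson ltr01.
    apply: measurableT_comp; first exact: mg.
    apply: measurable_funD; first exact: measurable_fst.
    by apply: measurable_funM; [exact: measurable_cst|exact: measurable_snd].
  by move=> p; rewrite lee_fin mulr_ge0.
- move=> l _; rewrite -[(g l)%:E]mule1 -(@integral_poisson1 R) -integralZl//; last first.
    exact: integrable_poisson1.
  apply: (@dominated_cvg _ _ _ leb setT measurableT _ _ (fun y => (B * poisson 1 y)%:E)).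
  - move=> n; apply/measurable_EFinP/measurable_funM; last first.
      by apply: continuous_measurable_fun; exact: continuous_poisson ltr01.
    apply: measurableT_comp; first exact: mg.
    apply: measurable_funD; first exact: measurable_cst.
    by apply: measurable_funM; [exact: measurable_cst|exact: measurable_id].
  - move=> y _; rewrite -EFinM; apply: cvg_EFin; first exact: nearW.
    apply: cvgM; last exact: cvg_cst.
    apply: (cvg_comp (fun n => l + harmonic n * y) g); last exact: cg.
    have : l + harmonic n * y @[n --> \oo] --> l + 0 * y.
      apply: cvgD; first exact: cvg_cst.
      by apply: cvgM; [exact: cvg_harmonic|exact: cvg_cst].
    by rewrite mul0r addr0.
  - by [].
  - exact: iBP.
  - move=> n y _; rewrite gee0_abs; rewrite lee_fin.
      exact: ler_wpM2r.
    exact: mulr_ge0.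
- by [].
- exact: integrable_cst.
- by move=> n l _; have /andP[q0 qB] := Qb n l; rewrite gee0_abs.
Qed.

Lemma poisson_mean_Rcvg_ge0 :
  (fun n => \int[leb]_x (g x * poisson_mean (harmonic n) x)) @ \oo --> \int[mu]_l g l.
Proof.
apply: fine_cvg; rewrite fineK; first exact: poisson_mean_cvg_ge0.
apply: integrable_fin_num => //.
apply: (integrable_bound _ _ (integrable_cst mu B)) => // l _.
by rewrite ger0_norm.
Qed.

End weak_limit.

Lemma integrable_psmooth e : 0 < e -> leb.-integrable setT (EFin \o poisson_mean e).
Proof.
move=> e0; apply: (@integrableT_ge0 _ _ mass) => [|x|].
- exact: measurable_psmooth.
- exact: poisson_mean_ge0.
have := @integral_psmooth (cst 1) (fun=> cvg_cst _) (fun=> ler01) e e0.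
under eq_integral do rewrite mul1r.
move=> ->.
have -> : (fun l => \int[leb]_y (cst 1 (l + e * y) * poisson 1 y)%:E)%E = cst 1%E.
  apply/funext => l; rewrite -(@integral_poisson1 R).
  by apply: eq_integral => y _; rewrite mul1r.
by rewrite integral_cst// mul1e fineK// fin_num_measure.
Qed.

(** Reduced to the nonnegative case by adding a constant to u. *)
Lemma poisson_mean_cvg (u : R -> R) (B : R) : continuous u -> (forall x, `|u x| <= B) ->
  (fun n => \int[leb]_x (u x * poisson_mean (harmonic n) x)) @ \oo --> \int[mu]_l u l.
Proof.
move=> cu uB; have B0 : 0 <= B := le_trans (normr_ge0 _) (uB 0).
have mu_ : measurable_fun setT u by exact: continuous_measurable_fun.
have iu n : leb.-integrable setT (EFin \o (fun x => u x * poisson_mean (harmonic n) x)).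
  have ips := integrable_scalel B measurableT (integrable_psmooth (harmonic_gt0 n)).
  apply: (integrable_bound _ _ ips) => //.
    by apply: measurable_funM => //; apply: measurable_psmooth; exact: harmonic_gt0.
  move=> x _; have p0 := poisson_mean_ge0 x (@harmonic_gt0 R n).
  by rewrite normrM [X in _ * X]ger0_norm// ler_wpM2r.
have iB n : leb.-integrable setT (EFin \o (fun x => B * poisson_mean (harmonic n) x)).
  by apply: integrable_scalel => //; apply: integrable_psmooth; exact: harmonic_gt0.
have imu : mu.-integrable setT (EFin \o u).
  exact: (integrable_bound _ _ (integrable_cst mu B)).
have c1 := @poisson_mean_Rcvg_ge0 (fun x => u x + B) (B + B).
have c2 : (fun n => \int[leb]_x (cst B x * poisson_mean (harmonic n) x)) @ \oo -->
    \int[mu]_l (cst B l).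
  by apply: (@poisson_mean_Rcvg_ge0 (cst B) B) => // x; exact: cvg_cst.
have {}c1 : (fun n => \int[leb]_x ((u x + B) * poisson_mean (harmonic n) x)) @ \oo -->
    \int[mu]_l (u l + B).
  apply: c1 => [x|x|x].
  - by apply: cvgD; [exact: cu|exact: cvg_cst].
  - by have := uB x; rewrite ler_norml => /andP[]; rewrite -subr_ge0 opprK.
  - by rewrite lerD2r (le_trans (ler_norm _) (uB x)).
have -> : (fun n => \int[leb]_x (u x * poisson_mean (harmonic n) x)) =
    (fun n => \int[leb]_x ((u x + B) * poisson_mean (harmonic n) x) -
              \int[leb]_x (cst B x * poisson_mean (harmonic n) x)).
  apply/funext => n; rewrite /cst -RintegralB//.
    by apply: eq_Rintegral => x _; rewrite mulrDl addrK.
  apply: eq_integrable (integrableD _ (iu n) (iB n)) => // x _ /=.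
  by rewrite -EFinD mulrDl.
have -> : \int[mu]_l u l = \int[mu]_l (u l + B) - \int[mu]_l (cst B l).
  by rewrite /cst RintegralD ?addrK//; exact: integrable_cst.
exact: (cvgB c1 c2).
Qed.

End smoothing.

(** * Abel summation of integrals *)

Section abel_summation.
Context (R : realType).
Local Notation leb := (@lebesgue_measure R).

(** Abel summation recovers an absolutely convergent integral. *)
Lemma Rintegral_abel_cvg (h : R -> R) : leb.-integrable setT (EFin \o h) ->
  (fun n => \int[leb]_t (abel (harmonic n) t * h t)) @ \oo --> \int[leb]_t h t.
Proof.
move=> ih; have mh : measurable_fun setT h.
  by apply/measurable_EFinP; exact: measurable_int ih.
apply: (Rintegral_dominated_cvg _ _ (integrable_norm ih)) => [n|t|n t].
- apply: measurable_funM => //.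
  by apply: continuous_measurable_fun; exact: continuous_abel.
- rewrite -[X in _ --> X](mul1r (h t)); apply: cvgM; last exact: cvg_cst.
  have : harmonic n * `|t| @[n --> \oo] --> 0 * `|t|.
    by apply: cvgM; [exact: cvg_harmonic|exact: cvg_cst].
  rewrite mul0r -[X in _ -> _ --> X]expR0 => /cvgN; rewrite oppr0 => H.
  by apply: (cvg_comp _ expR H); exact: continuous_expR.
- by rewrite normrM ger0_norm ?abel_ge0// ler_piMl ?abel_le1// ltW// harmonic_gt0.
Qed.

Lemma cintegral_abel_cvg (F : R -> R[i]) : cintegrable leb setT F ->
  (fun n => complex.Re (cintegral leb setT (fun t => (abel (harmonic n) t)%:C * F t)))
     @ \oo --> complex.Re (cintegral leb setT F) /\
  (fun n => complex.Im (cintegral leb setT (fun t => (abel (harmonic n) t)%:C * F t)))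
     @ \oo --> complex.Im (cintegral leb setT F).
Proof.
move=> [i1 i2]; split.
  by under eq_fun do rewrite Re_cintegral_real; exact: Rintegral_abel_cvg.
by under eq_fun do rewrite Im_cintegral_real; exact: Rintegral_abel_cvg.
Qed.

End abel_summation.

(** * Integration by parts against characters *)

Section schwartz_transform.
Context (R : realType).
Local Notation leb := (@lebesgue_measure R).
Local Notation K := (fun x : R => (1 + x ^+ 2)^-1).
Implicit Types (phi : R -> R[i]).

Lemma decay_den_gt0 (x : R) : 0 < 1 + x ^+ 2.
Proof. by rewrite ltr_pwDl ?sqr_ge0. Qed.

Lemma decayE (x : R) : K x = pi * poisson 1 x.
Proof.
rewrite /poisson expr1n mul1r invfM mulrA mulfV ?mul1r//.
by rewrite gt_eqF ?pi_gt0.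
Qed.

Lemma integrable_decay (B : R) : leb.-integrable setT (EFin \o (fun x => B * K x)).
Proof.
apply: integrable_scalel => //.
have := integrable_scalel pi measurableT (@integrable_poisson1 R).
by apply: eq_integrable => // x _ /=; rewrite -decayE.
Qed.

Lemma Rintegral_decay (B : R) : \int[leb]_x (B * K x) = B * pi.
Proof.
under eq_Rintegral do rewrite decayE mulrA.
rewrite RintegralZl//; last exact: integrable_poisson1.
by rewrite /Rintegral integral_poisson1 mulr1.
Qed.

(** The integral over [-n, n] is h n - h (- n), which tends to 0 by the decay
    of h. *)
Lemma integral_derive_decay (h h' : R -> R) (B : R) :
  (forall x : R, is_derive x (1 : R) h (h' x)) -> continuous h' ->
  leb.-integrable setT (EFin \o h') -> (forall x, `|h x| <= B * K x) ->
  \int[leb]_x h' x = 0.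
Proof.
move=> dh ch' ih' hB.
have mh' : measurable_fun setT h' by exact: continuous_measurable_fun.
pose J n : set R := `[- n.+1%:R, n.+1%:R]%classic.
have lim1 : (fun n => \int[leb]_x (h' \_ (J n)) x) @ \oo --> \int[leb]_x h' x.
  apply: (Rintegral_dominated_cvg _ _ (integrable_norm ih')) => [n|x|n x].
  - have mJ : measurable (J n : set (measurableTypeR R)) by exact: measurable_itv.
    by apply: (measurable_restrictT h' mJ).1; apply: measurable_funTS.
  - apply: cvg_near_cst; exists (Num.bound `|x|) => // n /= xn.
    rewrite patchE ifT// inE /J /= in_itv/= -ler_norml.
    by rewrite (le_trans (ltW (Num.Theory.archi_boundP (normr_ge0 x))))// ler_nat leqW.
  - by rewrite patchE /=; case: ifP => // _; rewrite normr0.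
have intJ n : \int[leb]_x (h' \_ (J n)) x = h n.+1%:R - h (- n.+1%:R).
  rewrite -Rintegral_mkcond /Rintegral.
  rewrite (@continuous_FTC2 _ h' h)//.
  - by rewrite gtrN.
  - exact: continuous_subspaceT.
  - have ch x : {for x, continuous h}.
      by apply: differentiable_continuous; apply/derivable1_diffP; have [] := dh x.
    split.
    + by move=> x _; have [] := dh x.
    + by apply: cvg_at_right_filter; exact: ch.
    + by apply: cvg_at_left_filter; exact: ch.
  - by move=> x _; rewrite derive1E; have [] := dh x.
(* The two endpoints, s = 1 and s = -1, are estimated together. *)
have hn (s : R) : s ^+ 2 = 1 -> (fun n => h (s * n.+1%:R)) @ \oo --> (0 : R).
  move=> s1; have Bh : B * harmonic n @[n --> \oo] --> B * 0.
    by apply: cvgM; [exact: cvg_cst|exact: cvg_harmonic].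
  rewrite mulr0 in Bh; apply/norm_cvg0P.
  apply: (@squeeze_cvgr _ _ _ _ (fun=> 0) _ _ _ _ (cvg_cst _) Bh).
  apply: nearW => n; rewrite normr_ge0 (le_trans (hB _))//.
  rewrite exprMn s1 mul1r.
  have B0 : 0 <= B by have := le_trans (normr_ge0 _) (hB 0);
    rewrite expr0n addr0 invr1 mulr1.
  rewrite ler_wpM2l// lef_pV2 ?posrE ?decay_den_gt0// ler_wpDl//.
  by rewrite expr2 ler_peMl// ler1n.
have lim2 : (fun n => \int[leb]_x (h' \_ (J n)) x) @ \oo --> (0 : R).
  rewrite (_ : (fun n => _) = (fun n => h (1 * n.+1%:R) - h (-1 * n.+1%:R))); last first.
    by apply/funext => n; rewrite intJ mul1r mulN1r.
  by rewrite -[0](subr0 (0 : R)); apply: cvgB; apply: hn; rewrite ?sqrrN expr1n.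
exact: (cvg_unique _ lim1 lim2).
Qed.

Lemma derivable_continuous1 (h h' : R -> R) :
  (forall x : R, is_derive x (1 : R) h (h' x)) -> continuous h.
Proof.
move=> dh x; apply: differentiable_continuous; apply/derivable1_diffP.
by have [] := dh x.
Qed.

Lemma cmeasurable_continuous (F : R -> R[i]) :
  continuous (fun x => complex.Re (F x)) -> continuous (fun x => complex.Im (F x)) ->
  cmeasurable setT F.
Proof. by move=> c1 c2; split; exact: continuous_measurable_fun. Qed.

Lemma cmeasurable_expiM t : cmeasurable setT (fun x : R => expi (t * x)).
Proof.
by apply: cmeasurable_expi; apply: measurable_funM;
  [exact: measurable_cst|exact: measurable_id].
Qed.

Section parts.
Variables (phi phi' : R -> R[i]) (B : R).
Hypothesis dRe : forall x : R,
  is_derive x (1 : R) (fun y => complex.Re (phi y)) (complex.Re (phi' x)).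
Hypothesis dIm : forall x : R,
  is_derive x (1 : R) (fun y => complex.Im (phi y)) (complex.Im (phi' x)).
Hypothesis cRe : continuous (fun y => complex.Re (phi' y)).
Hypothesis cIm : continuous (fun y => complex.Im (phi' y)).
Hypothesis bphi : forall x, normc (phi x) <= B * K x.
Hypothesis bphi' : forall x, normc (phi' x) <= B * K x.

(** The derivative of exp(itx) phi(x) has integral 0, because that function
    tends to 0 at both ends of the line. *)
Lemma fourier_derive t :
  cintegral leb setT (fun x => expi (t * x) * phi' x) =
  (0 +i* - t) * cintegral leb setT (fun x => expi (t * x) * phi x).
Proof.
have iE F : cmeasurable setT F -> (forall x, normc (F x) <= B * K x) ->
    cintegrable leb setT (fun x => expi (t * x) * F x).
  move=> mF FB; apply: (cintegrable_bound _ _ (integrable_decay B)) => //.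
    by apply: cmeasurableM => //; exact: cmeasurable_expiM.
  by move=> x _; rewrite normcM normc_expi mul1r.
have i0 : cintegrable leb setT (fun x => expi (t * x) * phi x).
  by apply: iE => //; apply: cmeasurable_continuous;
    [exact: derivable_continuous1 dRe|exact: derivable_continuous1 dIm].
have i1 : cintegrable leb setT (fun x => expi (t * x) * phi' x).
  by apply: iE => //; exact: cmeasurable_continuous.
(* The derivative of exp(itx) phi(x). *)
pose psi' x := (0 +i* t) * (expi (t * x) * phi x) + expi (t * x) * phi' x.
have cu := derivable_continuous1 dRe; have cv := derivable_continuous1 dIm.
have ct : continuous (fun x : R => t * x).
  by move=> x; apply: cvgM; [exact: cvg_cst|exact: cvg_id].
have cc : continuous (fun x : R => cos (t * x)).
  by move=> x; apply: continuous_comp; [exact: ct|exact: continuous_cos].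
have cs : continuous (fun x : R => sin (t * x)).
  by move=> x; apply: continuous_comp; [exact: ct|exact: continuous_sin].
have cMc (a b : R -> R) : continuous a -> continuous b -> continuous (fun x => a x * b x).
  by move=> ca cb x; apply: cvgM; [exact: ca|exact: cb].
have cDc (a b : R -> R) : continuous a -> continuous b -> continuous (fun x => a x + b x).
  by move=> ca cb x; apply: cvgD; [exact: ca|exact: cb].
have cBc (a b : R -> R) : continuous a -> continuous b -> continuous (fun x => a x - b x).
  by move=> ca cb x; apply: cvgB; [exact: ca|exact: cb].
have tc : continuous (fun _ : R => t) by move=> x; exact: cvg_cst.
have c1 : continuous (fun x => complex.Re (psi' x)).
  rewrite (_ : (fun x => _) = (fun x =>
    (cos (t * x) * complex.Re (phi' x) - sin (t * x) * complex.Im (phi' x)) -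
    t * (cos (t * x) * complex.Im (phi x) + sin (t * x) * complex.Re (phi x)))).
    exact: (cBc _ _ (cBc _ _ (cMc _ _ cc cRe) (cMc _ _ cs cIm))
      (cMc _ _ tc (cDc _ _ (cMc _ _ cc cv) (cMc _ _ cs cu)))).
  by apply/funext => x; rewrite /psi'; case: (phi x) (phi' x) => a b [a' b'] /=; ring.
have c2 : continuous (fun x => complex.Im (psi' x)).
  rewrite (_ : (fun x => _) = (fun x =>
    (cos (t * x) * complex.Im (phi' x) + sin (t * x) * complex.Re (phi' x)) +
    t * (cos (t * x) * complex.Re (phi x) - sin (t * x) * complex.Im (phi x)))).
    exact: (cDc _ _ (cDc _ _ (cMc _ _ cc cIm) (cMc _ _ cs cRe))
      (cMc _ _ tc (cBc _ _ (cMc _ _ cc cu) (cMc _ _ cs cv)))).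
  by apply/funext => x; rewrite /psi'; case: (phi x) (phi' x) => a b [a' b'] /=; ring.
have ipsi' : cintegrable leb setT psi'.
  apply: (cintegrable_bound _ _ (integrable_decay (`|t| * B + B))) => //.
    exact: cmeasurable_continuous.
  move=> x _; rewrite (le_trans (le_normcD _ _))// mulrDl lerD//.
    rewrite normcM (_ : normc (0 +i* t) = `|t|); last first.
      by rewrite normcE /sqmod /= expr0n add0r sqrtr_sqr.
    by rewrite normcM normc_expi mul1r -mulrA ler_wpM2l.
  by rewrite normcM normc_expi mul1r.
have dpsi (x : R) : is_derive x (1 : R) (fun x => complex.Re (expi (t * x) * phi x))
  (complex.Re (psi' x)) /\
   is_derive x (1 : R) (fun x => complex.Im (expi (t * x) * phi x)) (complex.Im (psi' x)).
  have dt : is_derive x 1 (fun x => t * x) t.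
    by apply: is_derive_eq; rewrite /GRing.scale /= mulr1.
  have ds : is_derive x 1 (fun x => sin (t * x)) (cos (t * x) * t).
    exact: (@is_derive1_comp _ sin (fun x => t * x)).
  have dc : is_derive x 1 (fun x => cos (t * x)) (- sin (t * x) * t).
    exact: (@is_derive1_comp _ cos (fun x => t * x)).
  have := dRe x; have := dIm x; rewrite /psi'.
  rewrite (_ : (fun x => complex.Re (expi (t * x) * phi x)) = (fun x =>
      cos (t * x) * complex.Re (phi x) - sin (t * x) * complex.Im (phi x))); last first.
    by apply/funext => y; case: (phi y).
  rewrite (_ : (fun x => complex.Im (expi (t * x) * phi x)) = (fun x =>
      cos (t * x) * complex.Im (phi x) + sin (t * x) * complex.Re (phi x))); last first.
    by apply/funext => y; case: (phi y).
  move=> d1 d2; split.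
    apply: is_derive_eq; rewrite /GRing.scale /=.
    by case: (phi x) (phi' x) => a b [a' b'] /=; ring.
  apply: is_derive_eq; rewrite /GRing.scale /=.
  by case: (phi x) (phi' x) => a b [a' b'] /=; ring.
have psi0 : cintegral leb setT psi' = 0.
  have [i2 i3] := ipsi'.
  have bpsi x : normc (expi (t * x) * phi x) <= B * K x by rewrite normcM normc_expi mul1r.
  apply/eqP; rewrite eq_complex /=; apply/andP; split; apply/eqP.
    apply: (@integral_derive_decay (fun x => complex.Re (expi (t * x) * phi x)) _ B) => //.
    - by move=> x; have [] := dpsi x.
    - by move=> x; rewrite (le_trans (Re_le_normc _)).
  apply: (@integral_derive_decay (fun x => complex.Im (expi (t * x) * phi x)) _ B) => //.
  - by move=> x; have [] := dpsi x.
  - by move=> x; rewrite (le_trans (Im_le_normc _)).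
move: psi0; rewrite /psi' cintegralP// => /eqP; rewrite addrC addr_eq0 => /eqP ->.
by rewrite -mulNr; congr (_ * _); apply/eqP; rewrite eq_complex /= oppr0 !eqxx.
Qed.

End parts.

End schwartz_transform.

(** * Schwartz functions and their Fourier transforms *)

Section schwartz.
Context (R : realType).
Local Notation leb := (@lebesgue_measure R).
Local Notation K := (fun x : R => (1 + x ^+ 2)^-1).
Implicit Types (phi psi : R -> R[i]).

Lemma cderiv0 phi : cderiv 0 phi = phi.
Proof. by apply/funext => x; rewrite /cderiv /=; case: (phi x). Qed.

Lemma schwartz_derive phi k : schwartz phi ->
  (forall x : R, is_derive x (1 : R) (fun y => complex.Re (cderiv k phi y))
     (complex.Re (cderiv k.+1 phi x))) /\
  (forall x : R, is_derive x (1 : R) (fun y => complex.Im (cderiv k phi y))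
     (complex.Im (cderiv k.+1 phi x))).
Proof.
move=> [dphi _]; split => x; have [d1 d2] := dphi k x.
  by apply: DeriveDef => //=; rewrite -derive1E.
by apply: DeriveDef => //=; rewrite -derive1E.
Qed.

Lemma schwartz_continuous phi k : schwartz phi ->
  continuous (fun x => complex.Re (cderiv k phi x)) /\
  continuous (fun x => complex.Im (cderiv k phi x)).
Proof.
move=> /(schwartz_derive k)[d1 d2].
by split; [exact: derivable_continuous1 d1|exact: derivable_continuous1 d2].
Qed.

Lemma schwartz_cmeasurable phi : schwartz phi -> cmeasurable setT phi.
Proof.
by move=> /(schwartz_continuous 0)[]; rewrite cderiv0; exact: cmeasurable_continuous.
Qed.

(** The hypothesis under which [tempered] asks for a bound by C * B. *)
Definition seminorm_le phi N (B : R) := forall m k, (m <= N)%N -> (k <= N)%N ->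
  forall x : R, (`|x| ^+ m)%:C * `|cderiv k phi x| <= B%:C.

Lemma seminorm_le_normc phi N B m k (x : R) : seminorm_le phi N B ->
  (m <= N)%N -> (k <= N)%N -> `|x| ^+ m * normc (cderiv k phi x) <= B.
Proof. by move=> H mN kN; have := H m k mN kN x; rewrite normr_normc -rmorphM /= lecR. Qed.

Lemma seminorm_decay phi B k (x : R) : seminorm_le phi 2 B -> (k <= 2)%N ->
  normc (cderiv k phi x) <= 2 * B * K x.
Proof.
move=> H k2; rewrite ler_pdivlMr ?decay_den_gt0// mulrDr mulr1.
have := seminorm_le_normc x H (leq0n 2) k2; have := seminorm_le_normc x H (leqnn 2) k2.
by rewrite real_normK ?num_real// expr0 mul1r; lra.
Qed.

Lemma schwartz_seminorm phi N : schwartz phi -> exists B, seminorm_le phi N B.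
Proof.
move=> [_ bphi].
have /boolp.choice[B Bphi] : forall mk : nat * nat, exists B : R, forall x : R,
    (`|x| ^+ mk.1)%:C * `|cderiv mk.2 phi x| <= B%:C by move=> [m k]; exact: bphi.
exists (\sum_(m < N.+1) \sum_(k < N.+1) `|B (m : nat, k : nat)|).
move=> m k mN kN x; apply: (le_trans (Bphi (m, k) x)); rewrite lecR.
rewrite (bigD1 (Ordinal (mN : (m < N.+1)%N)))//= (bigD1 (Ordinal (kN : (k < N.+1)%N)))//=.
by rewrite (le_trans (ler_norm _))// -addrA lerDl addr_ge0// sumr_ge0// => i _;
  rewrite sumr_ge0.
Qed.

Section bounded.
Variables (phi : R -> R[i]) (B : R).
Hypotheses (sphi : schwartz phi) (bphi : seminorm_le phi 2 B).

Lemma schwartz_decay x : normc (phi x) <= 2 * B * K x.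
Proof. by have := seminorm_decay x bphi (leq0n 2); rewrite cderiv0. Qed.

Lemma schwartz_fourier_integrable t :
  cintegrable leb setT (fun x => expi (t * x) * phi x).
Proof.
apply: (cintegrable_bound _ _ (integrable_decay (2 * B))) => //.
  by apply: cmeasurableM; [exact: cmeasurable_expiM|exact: schwartz_cmeasurable].
by move=> x _; rewrite normcM normc_expi mul1r schwartz_decay.
Qed.

(** Two integrations by parts multiply the Fourier integral by -t^2, so both
    that integral and t^2 times it are bounded by seminorms of phi. *)
Lemma fourier_inv_decay t : normc (fourier_inv phi t) <= 4 * B * K t.
Proof.
pose I k := cintegral leb setT (fun x => expi (t * x) * cderiv k phi x).
have bI k : (k <= 2)%N -> normc (I k) <= 4 * B * pi.
  move=> k2; have [c1 c2] := schwartz_continuous k sphi.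
  have mk : cmeasurable setT (fun x : measurableTypeR R => expi (t * x) * cderiv k phi x).
    by apply: cmeasurableM; [exact: cmeasurable_expiM|exact: cmeasurable_continuous].
  apply: (le_trans (normc_cintegral_le _ mk (integrable_decay (2 * B)) _)) => //.
    by move=> x _; rewrite normcM normc_expi mul1r seminorm_decay.
  by rewrite Rintegral_decay !mulrA -natrM.
have step k : (k <= 1)%N -> I k.+1 = (0 +i* - t) * I k.
  move=> k1; have [d1 d2] := schwartz_derive k sphi.
  have [c1 c2] := schwartz_continuous k.+1 sphi.
  apply: (@fourier_derive _ _ _ (2 * B)) => // x; apply: seminorm_decay => //.
  exact: leq_trans k1 _.
have I2 : normc (I 2%N) = t ^+ 2 * normc (I 0%N).
  rewrite !step// mulrA normcM; congr (_ * _).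
  rewrite normcM normcE /sqmod /= expr0n add0r sqrrN sqrtr_sqr.
  by rewrite -expr2 real_normK ?num_real.
have := bI 0%N isT; have := bI 2%N isT; rewrite I2 => b2 b0.
rewrite ler_pdivlMr ?decay_den_gt0// /fourier_inv normcM normc_real.
rewrite -/(I 0%N) -[phi]cderiv0 -/(I 0%N).
have p0 := pi_gt0 R; rewrite ger0_norm ?invr_ge0 ?mulr_ge0 ?(ltW p0)//.
rewrite -mulrA ler_pdivrMl ?mulr_gt0// mulrDr mulr1.
by lra.
Qed.

(** Dominated convergence makes the Fourier integral continuous in t. *)
Lemma cmeasurable_fourier_inv : cmeasurable setT (fourier_inv phi).
Proof.
apply: cmeasurableM; first exact: cmeasurable_cst.
have [c1 c2] := schwartz_continuous 0 sphi; rewrite cderiv0 in c1 c2.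
have mexp t : cmeasurable setT (fun x : R => expi (t * x) * phi x).
  by apply: cmeasurableM; [exact: cmeasurable_expiM|exact: schwartz_cmeasurable].
have bexp t x : normc (expi (t * x) * phi x) <= 2 * B * K x.
  by rewrite normcM normc_expi mul1r schwartz_decay.
have cont (h : R -> R -> R) :
    (forall t, measurable_fun (setT : set (measurableTypeR R)) (h t)) ->
    (forall x, continuous (h ^~ x)) -> (forall t x, `|h t x| <= 2 * B * K x) ->
    continuous (fun t => \int[leb]_x h t x).
  move=> mh ch hb t.
  have := @continuity_under_integral _ _ _ leb h setT
    measurableT (t - 1) (t + 1) _ _ _ (integrable_decay (2 * B)) _.
  apply => //.
  - move=> s _; apply: (integrable_bound _ (mh s) (integrable_decay (2 * B))) => //.
  - by apply: aeW => x _ s _; exact: ch.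
  - by move=> s _; apply: aeW => x _; exact: hb.
  - by rewrite inE /= in_itv/= ltrBlDr ltrDl ltr01.
have cx x : continuous (fun t : R => t * x).
  by move=> t; apply: cvgM; [exact: cvg_id|exact: cvg_cst].
have cc x : continuous (fun t : R => cos (t * x)).
  by move=> t; apply: continuous_comp; [exact: cx|exact: continuous_cos].
have cs x : continuous (fun t : R => sin (t * x)).
  by move=> t; apply: continuous_comp; [exact: cx|exact: continuous_sin].
split; apply: continuous_measurable_fun => /=; apply: cont.
- by move=> t; have [] := mexp t.
- move=> x; case: (phi x) => a b t /=.
  by apply: cvgB; apply: cvgM; [exact: cc|exact: cvg_cst|exact: cs|exact: cvg_cst].
- by move=> t x; rewrite (le_trans (Re_le_normc _)).
- by move=> t; have [] := mexp t.
- move=> x; case: (phi x) => a b t /=.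
  by apply: cvgD; apply: cvgM; [exact: cc|exact: cvg_cst|exact: cs|exact: cvg_cst].
- by move=> t x; rewrite (le_trans (Im_le_normc _)).
Qed.

End bounded.

End schwartz.

(** * Fourier inversion for finite measures in the sense of distributions *)

Section tempered_distributions.
Context (R : realType).
Local Notation leb := (@lebesgue_measure R).
Local Notation K := (fun x : R => (1 + x ^+ 2)^-1).
Implicit Types (phi psi F : R -> R[i]).

Section bounded_function.
Variables (F : R -> R[i]) (M : R).
Hypotheses (mF : cmeasurable setT F) (bF : forall t, normc (F t) <= M).

Lemma cintegrable_bounded_decay (psi : R -> R[i]) (B : R) :
  cmeasurable setT psi -> (forall t, normc (psi t) <= B * K t) ->
  cintegrable leb setT (fun t => F t * psi t).
Proof.
move=> mpsi bpsi; apply: (cintegrable_bound _ _ (integrable_decay (M * B))) => //.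
  exact: cmeasurableM.
by move=> t _; rewrite normcM -mulrA ler_pM ?normc_ge0.
Qed.

Lemma distr_fun_decay (psi : R -> R[i]) (B : R) :
  cmeasurable setT psi -> (forall t, normc (psi t) <= B * K t) ->
  normc (distr_fun F psi) <= 2 * (M * B * pi).
Proof.
move=> mpsi bpsi.
have mFpsi : cmeasurable (setT : set (measurableTypeR R)) (fun t : R => F t * psi t).
  exact: cmeasurableM.
rewrite -Rintegral_decay; apply: (normc_cintegral_le _ mFpsi (integrable_decay (M * B)))
  => //.
by move=> t _; rewrite normcM -mulrA ler_pM ?normc_ge0.
Qed.

Lemma tempered_distr_fun : tempered (distr_fun F).
Proof.
have iF phi : schwartz phi -> cintegrable leb setT (fun t => F t * phi t).
  move=> sphi; have [B bphi] := schwartz_seminorm 2 sphi.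
  apply: (cintegrable_bounded_decay (schwartz_cmeasurable sphi)) => t.
  exact: schwartz_decay bphi t.
split=> [a phi psi sphi spsi|].
  rewrite /distr_fun -cintegralP//; [|exact: iF|exact: iF].
  by congr cintegral; apply/funext => t; rewrite mulrDr mulrCA.
exists 2%N, (4 * M * pi) => phi B sphi bphi; rewrite normr_normc lecR.
apply: (le_trans (distr_fun_decay (schwartz_cmeasurable sphi) (schwartz_decay bphi))).
by rewrite le_eqVlt; apply/orP; left; apply/eqP; ring.
Qed.

Lemma tempered_distr_fourier_inv : tempered (distr_fourier_inv (distr_fun F)).
Proof.
have iF phi : schwartz phi -> cintegrable leb setT (fun t => F t * fourier_inv phi t).
  move=> sphi; have [B bphi] := schwartz_seminorm 2 sphi.
  apply: (cintegrable_bounded_decay (cmeasurable_fourier_inv sphi bphi)) => t.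
  exact: (fourier_inv_decay sphi bphi).
split=> [a phi psi sphi spsi|].
  rewrite /distr_fourier_inv /distr_fun -cintegralP//; [|exact: iF|exact: iF].
  congr cintegral; apply/funext => t.
  have -> : fourier_inv (fun x => a * phi x + psi x) t =
      a * fourier_inv phi t + fourier_inv psi t.
    have [B bphi] := schwartz_seminorm 2 sphi; have [B' bpsi] := schwartz_seminorm 2 spsi.
    rewrite /fourier_inv mulrCA -mulrDr; congr (_ * _); rewrite -cintegralP//.
    - by congr cintegral; apply/funext => x; rewrite mulrDr mulrCA.
    - exact: schwartz_fourier_integrable bphi t.
    - exact: schwartz_fourier_integrable bpsi t.
  by rewrite mulrDr mulrCA.
exists 2%N, (8 * M * pi) => phi B sphi bphi; rewrite normr_normc lecR.
apply: (le_trans (distr_fun_decay (cmeasurable_fourier_inv sphi bphi) (fourier_inv_decay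
  sphi bphi))).
by rewrite le_eqVlt; apply/orP; left; apply/eqP; ring.
Qed.

End bounded_function.

Section finite_measure.
Variable mu : {finite_measure set (measurableTypeR R) -> \bar R}.

Lemma cintegrable_schwartz phi : schwartz phi -> cintegrable mu setT phi.
Proof.
move=> sphi; have [B bphi] := schwartz_seminorm 0 sphi.
have mphi : cmeasurable (setT : set (measurableTypeR R)) phi by exact: schwartz_cmeasurable.
apply: (cintegrable_bound _ mphi (integrable_cst mu B)) => //.
by move=> x _; have := seminorm_le_normc x bphi (leqnn 0) (leqnn 0);
  rewrite cderiv0 expr0 mul1r.
Qed.

Lemma tempered_distr_measure : tempered (distr_measure mu).
Proof.
split=> [a phi psi sphi spsi|].
  by rewrite /distr_measure -cintegralP//; exact: cintegrable_schwartz.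
exists 0%N, (2 * fine (mu setT)) => phi B sphi bphi; rewrite normr_normc lecR.
have mphi : cmeasurable (setT : set (measurableTypeR R)) phi by exact: schwartz_cmeasurable.
apply: (le_trans (normc_cintegral_le _ mphi (integrable_cst mu B) _)) => //.
  by move=> x _; have := seminorm_le_normc x bphi (leqnn 0) (leqnn 0);
    rewrite cderiv0 expr0 mul1r.
by rewrite Rintegral_cstT -mulrA [B * _]mulrC.
Qed.

(** The regularised form of the inversion formula: both sides are iterated
    integrals of the same absolutely integrable function, in the two orders. *)
Lemma poisson_mean_fourier phi (e : R) : schwartz phi -> 0 < e ->
  cintegral leb setT (fun x => (poisson_mean mu e x)%:C * phi x) =
  cintegral leb setT (fun t => (abel e t)%:C * (charfun mu t * fourier_inv phi t)).
Proof.
move=> sphi e0; have [B bphi] := schwartz_seminorm 2 sphi.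
pose c := (2 * pi)^-1 : R.
have c0 : 0 <= c by rewrite invr_ge0 mulr_ge0// ltW// pi_gt0.
have cE : c%:C * (2 * pi)%:C = 1 :> R[i].
  by rewrite -rmorphM mulVf ?rmorph1// gt_eqF// mulr_gt0// pi_gt0.
pose F (p : measurableTypeR R * measurableTypeR R) : R[i] :=
  c%:C * ((abel e p.1)%:C * (expi (p.1 * p.2) * charfun mu p.1)) * phi p.2.
pose M := 2 * fine (mu setT).
have mchar := cmeasurable_charfun mu.
have mF : cmeasurable setT F.
  have mfst (G : measurableTypeR R -> R[i]) : cmeasurable setT G ->
      cmeasurable setT (fun p : measurableTypeR R * measurableTypeR R => G p.1).
    by move=> [G1 G2]; split; [exact: measurableT_comp G1 measurable_fst|
      exact: measurableT_comp G2 measurable_fst].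
  apply: cmeasurableM; last first.
    have [p1 p2] := schwartz_cmeasurable sphi.
    by split; [exact: measurableT_comp p1 measurable_snd|
      exact: measurableT_comp p2 measurable_snd].
  apply: cmeasurableM; first exact: cmeasurable_cst.
  apply: cmeasurableM.
    apply: (mfst (fun t => (abel e t)%:C)); apply: cmeasurable_real;
      apply: continuous_measurable_fun.
    exact: continuous_abel.
  apply: cmeasurableM; last exact: (mfst (charfun mu) mchar).
  by apply: cmeasurable_expi; apply: measurable_funM;
    [exact: measurable_fst|exact: measurable_snd].
have bF t x : normc (F (t, x)) <= abel e t * (c * M) * (2 * B * K x).
  rewrite -[F _]/(c%:C * ((abel e t)%:C * (expi (t * x) * charfun mu t)) * phi x).
  rewrite normcM ler_pM ?normc_ge0//; last exact: schwartz_decay.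
  rewrite !normcM !normc_real normc_expi mul1r (ger0_norm c0) ger0_norm ?abel_ge0//.
  by rewrite mulrCA ler_wpM2l ?abel_ge0// ler_wpM2l// normc_charfun.
have ig1 := integrable_scaler (c * M) measurableT (integrable_abel e0).
have [_ sw] := cintegral_swap ig1 (integrable_decay (2 * B)) mF bF.
transitivity (cintegral leb setT (fun x => cintegral leb setT (fun t => F (t, x)))).
  congr cintegral; apply/funext => x.
  transitivity (phi x * c%:C * cintegral leb setT
      (fun t => (abel e t)%:C * (expi (t * x) * charfun mu t))).
    rewrite cintegral_abel_charfun; last exact: e0.
    by rewrite rmorphM mulrA -[phi x * _ * _]mulrA cE mulr1 mulrC.
  rewrite -cintegralZ; [|exact: measurableT|exact: cintegrable_abel_charfun].
  have mulrCAA (u v w : R[i]) : w * u * v = u * v * w by rewrite -mulrA mulrC.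
  congr cintegral; apply/funext => t; exact: mulrCAA.
rewrite -sw; congr cintegral; apply/funext => t.
have rearrange (u v w z : R[i]) : v * w * u * z = u * (v * (w * z)) by ring.
rewrite -rearrange -cintegralZ; [|exact: measurableT|exact: schwartz_fourier_integrable
  bphi t].
have regroup (u v w y z : R[i]) : y * (u * (v * w)) * z = w * y * u * (v * z) by ring.
by congr cintegral; apply/funext => x; exact: regroup.
Qed.

(** The limit of [poisson_mean_fourier] as e tends to 0: the left side tends
    to the integral of phi against mu because phi is bounded and continuous, the
    right side by Abel summation because the inverse transform of phi decays. *)
Lemma fourier_inversion phi : schwartz phi ->
  distr_measure mu phi = distr_fourier_inv (distr_fun (charfun mu)) phi.
Proof.
move=> sphi; have [B bphi] := schwartz_seminorm 2 sphi.
have ib := cintegrable_bounded_decay (cmeasurable_charfun mu) (normc_charfun mu)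
  (cmeasurable_fourier_inv sphi bphi) (fourier_inv_decay sphi bphi).
have [] := cintegral_abel_cvg ib.
under eq_fun do rewrite -poisson_mean_fourier ?harmonic_gt0// Re_cintegral_real.
move=> l1.
under eq_fun do rewrite -poisson_mean_fourier ?harmonic_gt0// Im_cintegral_real.
move=> l2.
have bphi0 x : normc (phi x) <= B.
  by have := seminorm_le_normc x bphi (leq0n 2) (leq0n 2); rewrite cderiv0 expr0 mul1r.
have [cRe cIm] := schwartz_continuous 0 sphi; rewrite cderiv0 in cRe cIm.
have m1 := @poisson_mean_cvg _ mu _ B cRe (fun x => le_trans (Re_le_normc _) (bphi0 x)).
have m2 := @poisson_mean_cvg _ mu _ B cIm (fun x => le_trans (Im_le_normc _) (bphi0 x)).
have comm (u : R -> R) : (fun n => \int[leb]_x (u x * poisson_mean mu (harmonic n) x)) =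
    (fun n => \int[leb]_x (poisson_mean mu (harmonic n) x * u x)).
  by apply/funext => n; apply: eq_Rintegral => x _; rewrite mulrC.
rewrite comm in m1; rewrite comm in m2.
apply/eqP; rewrite eq_complex; apply/andP; split; apply/eqP.
  exact: (cvg_unique _ m1 l1).
exact: (cvg_unique _ m2 l2).
Qed.

End finite_measure.
End tempered_distributions.

(** * The density of a measure with integrable Fourier transform *)

Section density.
Context (R : realType).
Local Notation leb := (@lebesgue_measure R).
Variable mu : {finite_measure set (measurableTypeR R) -> \bar R}.
Hypothesis ichar : cintegrable leb setT (charfun mu).
Implicit Types x t : R.

Definition fourier_density x : R[i] :=
  ((2 * pi)^-1)%:C *
  cintegral leb setT (fun t : R => expi (t * x) * charfun mu t).

Let integrable_expi_charfun x :
  cintegrable leb setT (fun t : R => expi (t * x) * charfun mu t).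
Proof.
have mc : cmeasurable (setT : set (measurableTypeR R)) (charfun mu).
  exact: cmeasurable_charfun.
have [/integrable_norm i1 /integrable_norm i2] := ichar.
have i12 := integrableD measurableT i1 i2.
have mF : cmeasurable (setT : set (measurableTypeR R)) (fun t => expi (t * x) * charfun
  mu t).
  apply: cmeasurableM => //; apply: cmeasurable_expi.
  by apply: measurable_funM; [exact: measurable_id|exact: measurable_cst].
apply: (cintegrable_bound measurableT mF i12) => t _.
by rewrite normcM normc_expi mul1r normc_le_ReIm.
Qed.

Lemma poisson_mean_abel x (e : R) : 0 < e ->
  (poisson_mean mu e x)%:C = ((2 * pi)^-1)%:C *
    cintegral leb setT (fun t => (abel e t)%:C * (expi (t * x) * charfun mu t)).
Proof.
move=> e0; rewrite cintegral_abel_charfun// -rmorphM /= mulrA mulVf ?mul1r//.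
by rewrite gt_eqF// mulr_gt0// pi_gt0.
Qed.

(** Abel summation of the integral defining the density. *)
Lemma poisson_mean_cvg_density x :
  (fun n => poisson_mean mu (harmonic n) x) @ \oo --> complex.Re (fourier_density x).
Proof.
have [l1 _] := cintegral_abel_cvg (integrable_expi_charfun x).
have -> : complex.Re (fourier_density x) = (2 * pi)^-1 *
    complex.Re (cintegral leb setT (fun t : R => expi (t * x) * charfun mu t)).
  by rewrite /fourier_density /= mul0r subr0.
have -> : (fun n => poisson_mean mu (harmonic n) x) = (fun n => (2 * pi)^-1 *
  complex.Re (cintegral leb setT
    (fun t => (abel (harmonic n) t)%:C * (expi (t * x) * charfun mu t)))).
  apply/funext => n; have := congr1 (@complex.Re R) (poisson_mean_abel x (harmonic_gt0 n)).
  by case: (cintegral _ _ _) => a b /=; rewrite mul0r subr0.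
by apply: cvgM; [exact: cvg_cst|exact: l1].
Qed.

(** The Abel means of the inverse Fourier integral are Poisson means, hence
    real. *)
Lemma Im_density x : complex.Im (fourier_density x) = 0.
Proof.
have [_ l2] := cintegral_abel_cvg (integrable_expi_charfun x).
have -> : complex.Im (fourier_density x) = (2 * pi)^-1 *
    complex.Im (cintegral leb setT (fun t : R => expi (t * x) * charfun mu t)).
  by rewrite /fourier_density /= mul0r addr0.
apply/eqP; rewrite mulf_eq0; apply/orP; right; apply/eqP.
apply: (cvg_unique _ l2) => //.
rewrite (_ : (fun n => _) = cst 0); first exact: cvg_cst.
by apply/funext => n; rewrite cintegral_abel_charfun ?harmonic_gt0.
Qed.

Definition rdensity x : R := complex.Re (fourier_density x).

Lemma rdensity_ge0 x : 0 <= rdensity x.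
Proof.
apply: (@cvgr_to_ge _ _ _ _ _ _ 0 (@poisson_mean_cvg_density x)); apply: nearW => n.
by rewrite poisson_mean_ge0// harmonic_gt0.
Qed.

Lemma poisson_mean_bounded : exists C : R, forall n x, poisson_mean mu (harmonic n) x <= C.
Proof.
have mc : cmeasurable (setT : set (measurableTypeR R)) (charfun mu).
  exact: cmeasurable_charfun.
have [/integrable_norm i1 /integrable_norm i2] := ichar.
have i12 := integrableD measurableT i1 i2.
pose g t := `|complex.Re (charfun mu t)| + `|complex.Im (charfun mu t)|.
exists ((2 * pi)^-1 * (2 * \int[leb]_t g t)) => n x.
have e0 := @harmonic_gt0 R n.
have c0 : 0 <= (2 * pi)^-1 :> R by rewrite invr_ge0 mulr_ge0// ltW// pi_gt0.
have -> : poisson_mean mu (harmonic n) x = normc (poisson_mean mu (harmonic n) x)%:C.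
  by rewrite normc_real ger0_norm// poisson_mean_ge0.
rewrite poisson_mean_abel// normcM normc_real (ger0_norm c0) ler_wpM2l//.
apply: (normc_cintegral_le measurableT (cmeasurable_abel_charfun mu _ x) i12) => t _.
rewrite !normcM normc_real normc_expi mul1r ger0_norm ?abel_ge0//.
rewrite (le_trans _ (normc_le_ReIm _))// ler_piMl ?normc_ge0//.
by rewrite abel_le1// ltW.
Qed.

Lemma measurable_rdensity : measurable_fun setT rdensity.
Proof.
apply: (measurable_fun_cvg (fun n => measurable_psmooth mu (@harmonic_gt0 R n))).
by move=> x _; exact: poisson_mean_cvg_density.
Qed.

Section test_function.
Variables (g : R -> R) (B : R).
Hypotheses (cg : continuous g) (gB : forall x, `|g x| <= B).
Hypothesis ig : leb.-integrable setT (EFin \o g).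

(** Two limits of the integral of g against Poisson means of mu: the weak one,
    and the dominated one under the pointwise limit of the Poisson means. *)
Lemma integral_rdensity : \int[leb]_x (g x * rdensity x) = \int[mu]_x g x.
Proof.
have [C psC] := poisson_mean_bounded.
have l1 := @poisson_mean_cvg _ mu _ B cg gB.
apply: (cvg_unique _ _ l1) => //.
(* C bounds all the Poisson means. *)
have igC := integrable_scaler C measurableT (integrable_norm ig).
apply: (Rintegral_dominated_cvg _ _ igC) => [n|x|n x].
- apply: measurable_funM; first exact: continuous_measurable_fun.
  by apply: measurable_psmooth; exact: harmonic_gt0.
- by apply: cvgM; [exact: cvg_cst|exact: poisson_mean_cvg_density].
- by rewrite normrM ler_wpM2l// ger0_norm ?poisson_mean_ge0 ?harmonic_gt0.
Qed.

End test_function.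

Lemma rdensity_bounded : exists C : R, forall x, rdensity x <= C.
Proof.
have [C psC] := poisson_mean_bounded; exists C => x.
by apply: (cvgr_to_le (@poisson_mean_cvg_density x)); exact: nearW.
Qed.

Section interval.
Variables a b : R.

(** Continuous functions that converge to the indicator of ]a, b] everywhere,
    endpoints included: the slopes lie on [a, a + 1/(n+1)] and on
    [b, b + 1/(n+1)]. If b <= a the limit is the zero function, as it should be. *)
Definition trapezoid n x : R :=
  Num.max 0 (Num.min 1 (Num.min (n.+1%:R * (x - a)) (1 - n.+1%:R * (x - b)))).

Lemma continuous_trapezoid n : continuous (trapezoid n).
Proof.
have caff (c k e : R) : continuous (fun x : R => c + k * (x - e)).
  move=> x; apply: cvgD; first exact: cvg_cst.
  apply: cvgM; first exact: cvg_cst.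
  by apply: cvgB; [exact: cvg_id|exact: cvg_cst].
move=> x.
apply: (@continuous_max _ _ (fun=> 0) (fun x : R => Num.min 1
  (Num.min (n.+1%:R * (x - a)) (1 - n.+1%:R * (x - b))))); first exact: cvg_cst.
apply: (@continuous_min _ _ (fun=> 1) (fun x : R =>
  Num.min (n.+1%:R * (x - a)) (1 - n.+1%:R * (x - b)))); first exact: cvg_cst.
apply: (@continuous_min _ _ (fun x : R => n.+1%:R * (x - a))
  (fun x : R => 1 - n.+1%:R * (x - b))).
  by have := caff 0 n.+1%:R a x; under eq_fun do rewrite add0r.
by have := caff 1 (- n.+1%:R) b x; under eq_fun do rewrite mulNr.
Qed.

Lemma trapezoid_le n x : 0 <= trapezoid n x <= \1_(`[a, b + 1]%classic) x.
Proof.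
have n1 : 1 <= n.+1%:R :> R by rewrite ler1n.
rewrite /trapezoid le_max lexx /= ge_max.
rewrite indicE; case: (boolP (x \in _)) => /=.
  by move=> _; rewrite ler01 ge_min lexx.
rewrite lexx/= notin_setE /= in_itv/= => /negP; rewrite negb_and -!ltNge => /orP[xa|bx].
  have : n.+1%:R * (x - a) <= 0 by rewrite mulr_ge0_le0// subr_le0 ltW.
  by rewrite !ge_min => ->; rewrite orbT.
have : 1 - n.+1%:R * (x - b) <= 0.
  by rewrite subr_le0 (le_trans _ (ler_peMl _ n1))//; lra.
by rewrite !ge_min => ->; rewrite !orbT.
Qed.

Lemma trapezoid_cvg x :
  trapezoid ^~ x @ \oo --> (\1_(`]a, b]%classic) x : R).
Proof.
have near_big (c : R) : 0 < c -> \forall n \near \oo, 1 <= n.+1%:R * c.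
  move=> c0; near=> n; rewrite -ler_pdivrMr//.
  apply: (le_trans (ltW (archi_boundP _))); first by rewrite divr_ge0// ltW.
  by rewrite ler_nat leqW//; near: n; exact: nbhs_infty_ge.
apply: cvg_near_cst; rewrite indicE.
have [xa|ax] := leP x a.
  rewrite memNset /=; last by rewrite in_itv/= ltNge xa.
  apply: nearW => n; have : n.+1%:R * (x - a) <= 0 by rewrite mulr_ge0_le0// subr_le0.
  by move=> H; apply/eqP; rewrite eq_le le_max lexx andbT ge_max lexx /= !ge_min H orbT.
have [xb|bx] := leP x b.
  rewrite mem_set /=; last by rewrite in_itv/= ax xb.
  near=> n; have H1 : 1 <= n.+1%:R * (x - a).
    by near: n; apply: near_big; rewrite subr_gt0.
  have H2 : n.+1%:R * (x - b) <= 0 by rewrite mulr_ge0_le0// subr_le0.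
  by rewrite /trapezoid min_l ?max_r// le_min H1 lerBrDr gerDl.
rewrite memNset /=; last by rewrite in_itv/= ax leNgt bx.
near=> n; have H : 1 <= n.+1%:R * (x - b).
  by near: n; apply: near_big; rewrite subr_gt0.
by apply/eqP; rewrite eq_le le_max lexx andbT ge_max lexx /= !ge_min subr_le0 H !orbT.
Unshelve. all: by end_near. Qed.

Lemma itvoc_density : (mu `]a, b]%classic = \int[leb]_(x in `]a, b]) (rdensity x)%:E)%E.
Proof.
have [C pC] := rdensity_bounded.
have mt n : measurable_fun (setT : set (measurableTypeR R)) (trapezoid n).
  by apply: continuous_measurable_fun; exact: continuous_trapezoid.
have iI : leb.-integrable setT (EFin \o (\1_(`[a, b + 1]%classic) : R -> R)).
  exact: integrable_indic_itv.
have t0 n x : 0 <= trapezoid n x by have /andP[] := trapezoid_le n x.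
have tI n x : trapezoid n x <= \1_(`[a, b + 1]%classic) x by have /andP[] := trapezoid_le
  n x.
have t1 n x : `|trapezoid n x| <= 1.
  by rewrite ger0_norm// /trapezoid ge_max ler01 /= ge_min lexx.
have it n : leb.-integrable setT (EFin \o trapezoid n).
  by apply: (integrable_bound measurableT (mt n) iI) => x _; rewrite ger0_norm.
have E n := integral_rdensity (@continuous_trapezoid n) (t1 n) (it n).
have l1 : (fun n => \int[leb]_x (trapezoid n x * rdensity x)) @ \oo -->
    \int[leb]_x (\1_(`]a, b]%classic) x * rdensity x).
  apply: (Rintegral_dominated_cvg _ _ (integrable_scaler C measurableT iI)) => [n|x|n x].
  - by apply: measurable_funM => //; exact: measurable_rdensity.
  - by apply: cvgM; [exact: trapezoid_cvg|exact: cvg_cst].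
  - by rewrite normrM !ger0_norm ?rdensity_ge0// ler_pM ?rdensity_ge0.
have l2 : (fun n => \int[mu]_x trapezoid n x) @ \oo -->
    \int[mu]_x (\1_(`]a, b]%classic) x : R).
  exact: (Rintegral_dominated_cvg mt trapezoid_cvg (integrable_cst mu 1) t1).
have EE : (fun n => \int[mu]_x trapezoid n x) =
    (fun n => \int[leb]_x (trapezoid n x * rdensity x)).
  by apply/funext => n; rewrite E.
rewrite EE in l2.
have H : \int[mu]_x (\1_(`]a, b]%classic) x : R) =
    \int[leb]_x (\1_(`]a, b]%classic) x * rdensity x) by exact: (cvg_unique _ l2 l1).
have mD : measurable (`]a, b]%classic : set (measurableTypeR R)) by exact: measurable_itv.
have iD : leb.-integrable `]a, b]%classic (EFin \o rdensity).
  have iC : leb.-integrable `]a, b]%classic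
      (EFin \o (fun x => \1_(`[a, b + 1]%classic) x * C)).
    exact: integrableS (integrable_scaler C measurableT iI).
  apply: (integrable_bound mD _ iC) => [|x xab].
    by apply: measurable_funTS; exact: measurable_rdensity.
  rewrite indicE mem_set ?mul1r ?ger0_norm ?rdensity_ge0//=.
  move: xab; rewrite /= !in_itv/= => /andP[ax xb].
  by rewrite (ltW ax) (le_trans xb)// lerDl.
rewrite -EFin_Rintegral// -[LHS]fineK ?fin_num_measure//; congr EFin.
have -> : \int[leb]_(x in `]a, b]) rdensity x =
    \int[leb]_x (\1_(`]a, b]%classic) x * rdensity x).
  rewrite Rintegral_mkcond; apply: eq_Rintegral => x _.
  by rewrite patchE indicE; case: ifP => _; rewrite ?mul1r ?mul0r.
rewrite -H /Rintegral; congr fine.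
by have := integral_indic mu measurableT mD; rewrite setIT => <-.
Qed.

End interval.

Definition density_measure (S : set (measurableTypeR R)) : \bar R :=
  (\int[leb]_(x in S) (rdensity x)%:E)%E.

Let mp (S : set (measurableTypeR R)) : measurable_fun S (EFin \o rdensity).
Proof. by apply/measurable_EFinP; apply: measurable_funTS; exact: measurable_rdensity. Qed.

Let p0 (S : set (measurableTypeR R)) x : S x -> (0 <= (rdensity x)%:E)%E.
Proof. by move=> _; rewrite lee_fin rdensity_ge0. Qed.

Let density_measure0 : density_measure set0 = 0%E.
Proof. exact: integral_set0. Qed.

Let density_measure_ge0 S : (0 <= density_measure S)%E.
Proof. by apply: integral_ge0; exact: p0. Qed.

Let density_measure_sigma_additive : semi_sigma_additive density_measure.
Proof.
move=> F mF tF mUF; rewrite /density_measure ge0_integral_bigcup//; last exact: p0.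
by apply: is_cvg_ereal_nneg_natsum_cond => n _ _; exact: density_measure_ge0.
Qed.

HB.instance Definition _ := isMeasure.Build _ _ _ density_measure
  density_measure0 density_measure_ge0 density_measure_sigma_additive.

Lemma measure_density (S : set (measurableTypeR R)) : measurable S ->
  mu S = density_measure S.
Proof.
apply: (@measure_unique _ R (measurableTypeR R) (@ocitv R)
  (fun n => `](- n%:R), n%:R]%classic) _ _ _ _ mu density_measure) => //.
- exact: ocitvI.
- by move=> i; exact: is_ocitv.
- apply/seteqP; split => // x _; exists (Num.bound `|x|) => //=.
  by have := archi_boundP (normr_ge0 x); rewrite ltr_norml in_itv/= => /andP[-> /ltW].
- by move=> A [[a b] _ <-] /=; exact: itvoc_density.
- by move=> k; rewrite ltey_eq fin_num_measure//; exact: measurable_itv.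
Qed.

Lemma integrable_rdensity (S : set (measurableTypeR R)) : measurable S ->
  leb.-integrable S (EFin \o rdensity).
Proof.
move=> mS; apply/integrableP; split; first exact: mp.
rewrite (_ : (\int[leb]_(x in S) _)%E = mu S).
  by rewrite ltey_eq fin_num_measure.
rewrite measure_density//; apply: eq_integral => x _ /=.
by rewrite ger0_norm ?rdensity_ge0.
Qed.

Lemma charfun_abs_continuous : mu `<< leb.
Proof.
apply/null_content_dominatesP => S mS S0.
by rewrite measure_density//; apply: null_set_integral => //; exact: mp.
Qed.

(** The density is real by [Im_density], and integrable because its integral
    over the line is the finite mass of mu. *)
Lemma charfun_has_density : has_density mu fourier_density.
Proof.
have Im0 : (fun x => complex.Im (fourier_density x)) = cst 0.
  by apply/funext => x; exact: Im_density.
split.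
  split; first exact: integrable_rdensity.
  by rewrite [X in _.-integrable _ X](_ : _ = cst 0%E) ?integrable0//; apply/funext => x;
    rewrite Im_density.
move=> S mS; rewrite /cintegral /= measure_density//; split.
  by rewrite EFin_Rintegral//; exact: integrable_rdensity.
by rewrite Im0 /Rintegral integral0.
Qed.

End density.

(** * Spectral measures *)

Section prehilbert.
Context (R : realType) (H : preHilbertType R).
Implicit Types u v w : H.

Lemma innerBl v w u : inner (v - w) u = inner v u - inner w u.
Proof. by rewrite addrC -scaleN1r inner_linear mulN1r addrC. Qed.

Lemma innerBr u v w : inner u (v - w) = inner u v - inner u w.
Proof. by rewrite inner_conj innerBl rmorphB /= -!inner_conj. Qed.

Lemma inner0l u : inner 0 u = 0.
Proof. by rewrite -(subrr u) innerBl subrr. Qed.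

Lemma inner_linear_r u (a : R[i]) v w :
  inner u (a *: v + w) = a^*%C * inner u v + inner u w.
Proof. by rewrite inner_conj inner_linear rmorphD rmorphM /= -!inner_conj. Qed.

Lemma innerZl (a : R[i]) v u : inner (a *: v) u = a * inner v u.
Proof. by rewrite -[a *: v]addr0 inner_linear inner0l addr0. Qed.

Lemma innerZr u (a : R[i]) v : inner u (a *: v) = a^*%C * inner u v.
Proof. by rewrite inner_conj innerZl rmorphM /= -inner_conj. Qed.

Lemma hnorm_ge0 v : 0 <= hnorm v. Proof. exact: sqrtr_ge0. Qed.

Lemma inner_selfE v : inner v v = (hnorm v ^+ 2)%:C.
Proof.
have := inner_ge0 v; rewrite lecE => /andP[/eqP Im0 Re0].
rewrite /hnorm sqr_sqrtr//; move: Im0.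
by case: (inner v v) => a b /= ->.
Qed.

Lemma hnormB_sqr v w : hnorm (v - w) ^+ 2 =
  hnorm v ^+ 2 + hnorm w ^+ 2 - 2 * complex.Re (inner v w).
Proof.
apply/(@complexI R); rewrite -inner_selfE innerBl !innerBr !inner_selfE [inner w
  v]inner_conj.
by case: (inner v w) => a b; apply/eqP; rewrite eq_complex /=; apply/andP; split;
  apply/eqP; ring.
Qed.

Lemma hnormZ_sqr (a : R[i]) v : hnorm (a *: v) ^+ 2 = sqmod a * hnorm v ^+ 2.
Proof.
apply/(@complexI R); rewrite -inner_selfE innerZl innerZr inner_selfE mulrA -sqmod_conj.
by rewrite -rmorphM.
Qed.

(** The squared distance from w to its projection on the line of u is
    nonnegative. *)
Lemma bessel_unit u w : hnorm u = 1 -> sqmod (inner w u) <= hnorm w ^+ 2.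
Proof.
move=> u1; have := sqr_ge0 (hnorm (w - inner w u *: u)).
rewrite hnormB_sqr hnormZ_sqr u1 expr1n mulr1 innerZr [_ * inner w u]mulrC -sqmod_conj /=.
by lra.
Qed.

End prehilbert.

Section spectral.
Context (R : realType) (H : preHilbertType R) (E : spectral_family H) (u : H).
Local Notation cdf := (spectral_cdf E u).

(** The product of the projections E_l and E_m is E_(min l m), and the
    symmetry of that projection makes the inner product real. *)
Lemma inner_resol l m : inner (E l u) (E m u) = (cdf (Num.min l m))%:C.
Proof.
rewrite -resol_symmetric resol_min minC /spectral_cdf; set k := Num.min l m.
have : inner (E k u) u = (inner (E k u) u)^*%C by rewrite -inner_conj resol_symmetric.
by case: (inner (E k u) u) => a b [] /= /eqP;
  rewrite -addr_eq0 -mulr2n mulrn_eq0 /= => /eqP ->.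
Qed.

Lemma inner_resol_u l : inner (E l u) u = (cdf l)%:C.
Proof. by rewrite -[l in RHS]minxx -inner_resol -resol_symmetric resol_min minxx. Qed.

Lemma hnorm_resol l : hnorm (E l u) ^+ 2 = cdf l.
Proof. by apply/(@complexI R); rewrite -inner_selfE inner_resol minxx. Qed.

Lemma cdf_ninfty : cdf @ -oo --> (0 : R).
Proof.
rewrite (_ : spectral_cdf E u = (fun l => hnorm (E l u) * hnorm (E l u))); last first.
  by apply/funext => l; rewrite -expr2 hnorm_resol.
by rewrite -(mulr0 0); apply: cvgM; exact: resol_ninfty.
Qed.

(** Pythagoras: E_l u is the orthogonal projection of u, so that
    cdf l = |u|^2 - |E_l u - u|^2. *)
Lemma cdf_pinfty : cdf @ +oo --> hnorm u ^+ 2.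
Proof.
rewrite (_ : spectral_cdf E u =
    (fun l => hnorm u ^+ 2 - hnorm (E l u - u) * hnorm (E l u - u))); last first.
  apply/funext => l; rewrite -expr2 hnormB_sqr hnorm_resol inner_resol_u /=; ring.
rewrite -[X in _ --> X]subr0 -(mulr0 0); apply: cvgB; first exact: cvg_cst.
by apply: cvgM; exact: resol_pinfty.
Qed.

Lemma spectral_measure_itvoc a b : a <= b ->
  spectral_measure E u `]a, b]%classic = (cdf b - cdf a)%:E.
Proof.
move=> ab; rewrite /spectral_measure /lebesgue_stieltjes_measure /measure_extension.
rewrite measurable_mu_extE/=; last exact: is_ocitv.
by rewrite wlength_itv_bnd.
Qed.

Lemma spectral_measureT : spectral_measure E u setT = (hnorm u ^+ 2)%:E.
Proof.
rewrite -(bigcup_itvT false false).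
pose I n : set R := `]- (n%:R), n%:R]%classic.
have l1 : (spectral_measure E u \o I) n @[n --> \oo] --> (hnorm u ^+ 2)%:E.
  rewrite (_ : _ \o _ = (fun n => (cdf n%:R - cdf (- n%:R))%:E)); last first.
    by apply/funext => n; rewrite /= spectral_measure_itvoc// ge0_cp.
  apply: cvg_EFin; first exact: nearW.
  rewrite -[X in _ --> X]subr0; apply: cvgB.
    by apply: cvg_comp cdf_pinfty; exact: cvgr_idn.
  apply: cvg_comp cdf_ninfty; apply: (cvg_comp _ _ (@cvgr_idn R)); rewrite ninfty.
  exact: cvg_id.
have l2 : (spectral_measure E u \o I) n @[n --> \oo] --> spectral_measure E u (\bigcup_n
  I n).
  apply: nondecreasing_cvg_mu; rewrite /I//; first exact: bigcup_measurable.
  by move=> *; apply/subsetPset/subset_itv; rewrite leBSide/= ?lerN2 ler_nat.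
exact: (cvg_unique _ l2 l1).
Qed.

End spectral.

Section spectral_finite.
Context (R : realType) (H : preHilbertType R) (E : spectral_family H) (u : H).

Let spectral_measure_fin : fin_num_fun (spectral_measure E u).
Proof.
have fin : (spectral_measure E u setT < +oo)%E by rewrite spectral_measureT ltry.
by apply: lty_fin_num_fun; exact: fin.
Qed.

HB.instance Definition _ := Measure_isFinite.Build _ _ _ (spectral_measure E u)
  spectral_measure_fin.

End spectral_finite.

(** * Integrals of step functions against a spectral family *)

Section step_integrals.
Context (R : realType) (H : preHilbertType R) (E : spectral_family H) (u : H).
Local Notation mu := (spectral_measure E u).
Local Notation step := (R[i] * (R * R))%type.
Local Notation ind p := (fun x : R => (\1_(`]p.2.1, p.2.2]%classic) x)%:C : R[i]).
Local Notation cdf := (spectral_cdf E u).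

Lemma cmeasurable_ind (p : step) : cmeasurable setT (ind p).
Proof. by apply: cmeasurable_real; apply: measurable_indic; exact: measurable_itv. Qed.

Lemma normc_ind (p : step) x : normc (ind p x) <= 1.
Proof. by rewrite normc_real indicE; case: (_ \in _); rewrite ?normr1 ?normr0 ?ler01. Qed.

Definition step_bound (s : seq step) : R := \sum_(p <- s) normc p.1.

Lemma step_fun_cons (p : step) s :
  step_fun (p :: s) = (fun x => p.1 * ind p x + step_fun s x).
Proof. by apply/funext => x; rewrite /step_fun big_cons. Qed.

Lemma step_fun_nil : @step_fun R [::] = (fun=> 0).
Proof. by apply/funext => x; rewrite /step_fun big_nil. Qed.

Lemma cmeasurable_step_fun (s : seq step) : cmeasurable setT (step_fun s).
Proof.
elim: s => [|p s IH]; first by rewrite step_fun_nil; exact: cmeasurable_cst.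
rewrite step_fun_cons; apply: cmeasurableD => //.
by apply: cmeasurableM; [exact: cmeasurable_cst|exact: cmeasurable_ind].
Qed.

Lemma normc_step_fun (s : seq step) x : normc (step_fun s x) <= step_bound s.
Proof.
elim: s => [|p s IH].
  by rewrite step_fun_nil /step_bound big_nil (_ : 0 = 0%:C)// normc_real normr0.
rewrite step_fun_cons /step_bound big_cons (le_trans (le_normcD _ _))// lerD//.
by rewrite normcM ler_piMr ?normc_ge0// normc_ind.
Qed.

Lemma cintegrable_step_mul (s : seq step) (G : R -> R[i]) (M : R) :
  cmeasurable (setT : set (measurableTypeR R)) G -> (forall x, normc (G x) <= M) ->
  cintegrable mu setT (fun x => step_fun s x * G x).
Proof.
move=> mG bG; apply: (@cintegrable_bounded _ mu _ (step_bound s * M)).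
  by apply: cmeasurableM => //; exact: cmeasurable_step_fun.
by move=> x; rewrite normcM ler_pM ?normc_ge0// normc_step_fun.
Qed.

(** The four-term expression is what the inner product of two increments
    E_b u - E_a u and E_d u - E_c u expands to. *)
Lemma spectral_measure_itvI a b c d : a <= b -> c <= d ->
  mu (`]a, b]%classic `&` `]c, d]%classic) =
  (cdf (Num.min b d) - cdf (Num.min a d) - cdf (Num.min b c) + cdf (Num.min a c))%:E.
Proof.
move=> ab cd.
have -> : `]a, b]%classic `&` `]c, d]%classic = `]Num.max a c, Num.min b d]%classic.
  apply/seteqP; split => x; rewrite /= !in_itv/= gt_max le_min.
    by move=> [/andP[-> ->] /andP[-> ->]].
  by move=> /andP[/andP[-> ->] /andP[-> ->]].
have [ml|lm] := leP (Num.max a c) (Num.min b d).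
  rewrite spectral_measure_itvoc//; congr EFin.
  move: ml; rewrite ge_max !le_min => /andP[/andP[_ ad] /andP[cb _]].
  rewrite (min_idPl ad) (min_idPr cb).
  by have [ac|ca] := leP a c; ring.
rewrite set_itv_ge -?leNgt ?bnd_simp ?ltW// measure0; congr EFin.
move: lm; rewrite gt_min !lt_max => /orP[/orP[|bc]|/orP[da|]].
- by rewrite ltNge ab.
- rewrite (min_idPl (ltW bc)) (min_idPl (le_trans (ltW bc) cd)).
  rewrite (min_idPl (le_trans ab (ltW bc))) (min_idPl (le_trans (le_trans ab (ltW bc)) cd)).
  ring.
- rewrite (min_idPr (ltW da)) (min_idPr (le_trans (ltW da) ab)).
  rewrite (min_idPr (le_trans cd (ltW da))) (min_idPr (le_trans cd (le_trans (ltW da) ab))).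
  ring.
- by rewrite ltNge cd.
Qed.

Definition incr (p : step) : H := E p.2.2 u - E p.2.1 u.

Lemma inner_incr (p q : step) : p.2.1 <= p.2.2 -> q.2.1 <= q.2.2 ->
  inner (incr p) (incr q) = cintegral mu setT (fun x => ind p x * ind q x).
Proof.
move=> pp qq; rewrite /incr innerBl !innerBr !inner_resol.
have mI : measurable (`]p.2.1, p.2.2]%classic `&` `]q.2.1, q.2.2]%classic :
    set (measurableTypeR R)) by apply: measurableI; exact: measurable_itv.
have -> : (fun x => ind p x * ind q x) = (fun x =>
    (\1_(`]p.2.1, p.2.2]%classic `&` `]q.2.1, q.2.2]%classic) x)%:C).
  by apply/funext => x; rewrite -rmorphM /= indicI.
apply/eqP; rewrite eq_complex /=; apply/andP; split; apply/eqP; last first.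
  by rewrite /Rintegral integral0 !subr0.
rewrite /Rintegral integral_indic// setIT [X in fine X](spectral_measure_itvI pp qq) /=.
ring.
Qed.

Lemma step_integral_cons (p : step) s :
  step_integral E (p :: s) u = p.1 *: incr p + step_integral E s u.
Proof. by rewrite /step_integral big_cons. Qed.

Lemma step_integral_nil : step_integral E [::] u = 0.
Proof. by rewrite /step_integral big_nil. Qed.

Lemma inner_step_incr s (q : step) : step_ok s -> q.2.1 <= q.2.2 ->
  inner (step_integral E s u) (incr q) =
  cintegral mu setT (fun x => step_fun s x * ind q x).
Proof.
move=> + qq; elim: s => [_|p s IH /= /andP[pp ok]].
  rewrite step_integral_nil inner0l step_fun_nil; under eq_fun do rewrite mul0r.
  by rewrite /cintegral /= /Rintegral integral0.
rewrite step_integral_cons inner_linear inner_incr// IH// -cintegralP//.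
- by congr cintegral; apply/funext => x; rewrite step_fun_cons mulrDl mulrA.
- apply: (@cintegrable_bounded _ mu _ (1 * 1)).
    by apply: cmeasurableM; exact: cmeasurable_ind.
  by move=> x; rewrite normcM ler_pM ?normc_ge0 ?normc_ind.
- apply: (@cintegrable_step_mul _ _ 1); first exact: cmeasurable_ind.
  exact: normc_ind.
Qed.

(** The isometry in polarised form; it reduces by sesquilinearity to the
    increments of [inner_incr]. *)
Lemma inner_step s t : step_ok s -> step_ok t ->
  inner (step_integral E s u) (step_integral E t u) =
  cintegral mu setT (fun x => step_fun s x * (step_fun t x)^*%C).
Proof.
move=> oks; elim: t => [_|q t IH /= /andP[qq okt]].
  rewrite step_integral_nil inner_conj inner0l step_fun_nil.
  under eq_fun do rewrite rmorph0 mulr0.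
  by rewrite rmorph0 /cintegral /= /Rintegral integral0.
rewrite step_integral_cons inner_linear_r inner_step_incr// IH// -cintegralP//.
- congr cintegral; apply/funext => x; rewrite step_fun_cons rmorphD rmorphM /= mulrDr.
  by rewrite mulrCA oppr0.
- apply: (@cintegrable_step_mul _ _ 1); first exact: cmeasurable_ind.
  exact: normc_ind.
- apply: (@cintegrable_step_mul _ _ (step_bound t)).
    by apply: cmeasurable_conj; exact: cmeasurable_step_fun.
  by move=> x; rewrite normc_conj normc_step_fun.
Qed.

Lemma hnorm_step s : step_ok s ->
  hnorm (step_integral E s u) ^+ 2 = \int[mu]_x sqmod (step_fun s x).
Proof.
move=> oks; have := inner_step oks oks; rewrite inner_selfE => /(congr1 (@complex.Re R))
  /= ->.
by apply: eq_Rintegral => x _; case: (step_fun s x) => a b; rewrite /sqmod /=; ring.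
Qed.

(** Since step functions are lists, s ++ negate t stands for the difference of
    s and t. *)
Definition negate (s : seq step) := [seq (- p.1, p.2) | p <- s].

Lemma step_ok_sub s t : step_ok s -> step_ok t -> step_ok (s ++ negate t).
Proof. by rewrite /step_ok all_cat => -> /=; rewrite all_map. Qed.

Lemma step_fun_sub s t x : step_fun (s ++ negate t) x = step_fun s x - step_fun t x.
Proof.
rewrite /step_fun big_cat big_map /= -sumrN; congr (_ + _).
by apply: eq_bigr => p _; rewrite mulNr.
Qed.

Lemma step_integral_sub s t :
  step_integral E (s ++ negate t) u = step_integral E s u - step_integral E t u.
Proof.
rewrite /step_integral big_cat big_map /= -sumrN; congr (_ + _).
by apply: eq_bigr => p _; rewrite scaleNr.
Qed.

Lemma inner_step_u s : step_ok s ->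
  inner (step_integral E s u) u = cintegral mu setT (step_fun s).
Proof.
elim: s => [_|p s IH /= /andP[pp ok]].
  by rewrite step_integral_nil inner0l step_fun_nil /cintegral /= /Rintegral integral0.
rewrite step_integral_cons inner_linear IH// step_fun_cons cintegralP//; last 2 first.
- exact: (cintegrable_bounded mu (cmeasurable_ind p) (normc_ind p)).
- exact: (cintegrable_bounded mu (cmeasurable_step_fun s) (normc_step_fun s)).
congr (_ * _ + _); rewrite /incr innerBl !inner_resol_u.
have mI : measurable (`]p.2.1, p.2.2]%classic : set (measurableTypeR R)).
  exact: measurable_itv.
apply/eqP; rewrite eq_complex /=; apply/andP; split; apply/eqP; last first.
  by rewrite /Rintegral integral0 subr0.
by rewrite /Rintegral integral_indic// setIT [X in fine X]spectral_measure_itvoc.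
Qed.

End step_integrals.

(** * Spectral integrals of bounded functions *)

Section spectral_integrals.
Context (R : realType) (H : preHilbertType R) (E : spectral_family H) (u : H).
Local Notation mu := (spectral_measure E u).
Local Notation step := (R[i] * (R * R))%type.
Variables (h : R -> R[i]) (M : R).
Hypotheses (mh : cmeasurable (setT : set (measurableTypeR R)) h)
  (bh : forall x, normc (h x) <= M).

Lemma cmeasurable_error (s : seq step) :
  cmeasurable (setT : set (measurableTypeR R)) (fun x => h x - step_fun s x).
Proof. by apply: cmeasurableD => //; apply: cmeasurableN; exact: cmeasurable_step_fun. Qed.

Lemma normc_error (s : seq step) x : normc (h x - step_fun s x) <= M + step_bound s.
Proof. by rewrite (le_trans (le_normcD _ _))// normcN lerD// normc_step_fun. Qed.

Definition sq_error (s : seq step) : R := \int[mu]_x sqmod (h x - step_fun s x).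

Lemma integrable_sq_error s :
  mu.-integrable setT (EFin \o (fun x => sqmod (h x - step_fun s x))).
Proof. exact: (integrable_sqmod mu (cmeasurable_error s) (normc_error s)). Qed.

Lemma EFin_sq_error s :
  ((sq_error s)%:E = \int[mu]_x (sqmod (h x - step_fun s x))%:E)%E.
Proof. exact: (EFin_Rintegral measurableT (integrable_sq_error s)). Qed.

Lemma sq_error_cvg (s : nat -> seq step) :
  ((fun k => \int[mu]_x (sqmod (h x - step_fun (s k) x))%:E) @ \oo --> 0)%E <->
  (fun k => sq_error (s k)) @ \oo --> (0 : R).
Proof.
rewrite (_ : (fun k => _) = EFin \o (fun k => sq_error (s k))); last first.
  by apply/funext => k; rewrite -EFin_sq_error.
split=> [|l]; first by move/fine_cvg.
by apply: cvg_EFin => //; exact: nearW.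
Qed.

Lemma hnorm_stepB s t : step_ok s -> step_ok t ->
  hnorm (step_integral E s u - step_integral E t u) ^+ 2 <=
  2 * sq_error s + 2 * sq_error t.
Proof.
move=> oks okt; rewrite -step_integral_sub (hnorm_step _ _ (step_ok_sub oks okt)).
have i1 := integrable_scalel 2 measurableT (integrable_sq_error s).
have i2 := integrable_scalel 2 measurableT (integrable_sq_error t).
rewrite -!RintegralZl//; [|exact: integrable_sq_error|exact: integrable_sq_error].
rewrite -RintegralD//; apply: le_Rintegral => //.
- exact: (integrable_sqmod mu (cmeasurable_step_fun _) (normc_step_fun _)).
- exact: integrableD i1 i2.
move=> x _; rewrite step_fun_sub.
rewrite (_ : _ - _ = - (h x - step_fun s x) + (h x - step_fun t x)).
  by rewrite -(sqmodN (h x - step_fun s x)) sqmodD_le.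
by ring.
Qed.

(** By the isometry, step functions that converge in L^2 have a Cauchy
    sequence of spectral integrals. *)
Lemma spectral_integral_exists : is_hilbert H ->
  (exists s : nat -> seq step, (forall k, step_ok (s k)) /\
     (fun k => sq_error (s k)) @ \oo --> (0 : R)) ->
  exists v, spectral_integral E h u v.
Proof.
move=> [_ compl] [s [oks serr]].
have [v sv] : exists v, hcvg (fun k => step_integral E (s k) u) v.
  apply: compl => e e0.
  (* The isometry bounds the squared distance of two terms by twice the sum of
     their errors, hence the 4. *)
  have e4 : 0 < e ^+ 2 / 4 by rewrite divr_gt0 ?exprn_gt0.
  have /cvgrPdist_lt /(_ _ e4) [N _ HN] := serr.
  have HN' k : (N <= k)%N -> sq_error (s k) < e ^+ 2 / 4.
    by move=> /HN /=; rewrite sub0r normrN; apply: le_lt_trans; exact: ler_norm.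
  exists N => k l Nk Nl; rewrite -(@ltr_pXn2r _ 2) ?nnegrE ?hnorm_ge0 ?(ltW e0)//.
  rewrite (le_lt_trans (hnorm_stepB (oks k) (oks l)))//.
  by have := HN' _ Nk; have := HN' _ Nl; lra.
by exists v, s; split => //; exact/sq_error_cvg.
Qed.

(** Valid for whichever approximating step functions witness the spectral
    integral, hence for the vector picked in the definition of exp(-itA). On
    step functions the identity is [inner_step_u]; both sides are continuous for
    the convergence of [spectral_integral]. *)
Lemma inner_spectral_integral v : hnorm u = 1 ->
  spectral_integral E h u v -> inner v u = cintegral mu setT h.
Proof.
move=> u1 [s [oks /sq_error_cvg serr sv]].
pose d := sqmod (inner v u - cintegral mu setT h).
have dle k : d <= 2 * (hnorm (step_integral E (s k) u - v) * hnorm (step_integral E (s k)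
  u - v)) + 2 * sq_error (s k).
  have muT : fine (mu setT) = 1 by rewrite spectral_measureT u1 expr1n.
  have hb := sqmod_cintegral_le muT (cmeasurable_error (s k)) (normc_error (s k)).
  have bb := bessel_unit (step_integral E (s k) u - v) u1.
  rewrite innerBl inner_step_u// in bb.
  have ch : cintegral mu setT (fun x => h x - step_fun (s k) x) =
      cintegral mu setT h - cintegral mu setT (step_fun (s k)).
    rewrite addrC -mulN1r -cintegralP//.
    - by congr cintegral; apply/funext => x; rewrite mulN1r addrC.
    - exact: (cintegrable_bounded mu (cmeasurable_step_fun _) (normc_step_fun _)).
    - exact: (cintegrable_bounded mu mh bh).
  rewrite ch in hb; rewrite -expr2.
  apply: (@le_trans _ _ (2 * sqmod (cintegral mu setT (step_fun (s k)) - inner v u) +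
     2 * sqmod (cintegral mu setT h - cintegral mu setT (step_fun (s k))))); last first.
    by rewrite lerD// ler_wpM2l.
  rewrite /d -sqmodN (_ : - _ = (cintegral mu setT (step_fun (s k)) - inner v u) +
    (cintegral mu setT h - cintegral mu setT (step_fun (s k)))) ?sqmodD_le//.
  by ring.
have l0 : (fun k => 2 * (hnorm (step_integral E (s k) u - v) * hnorm (step_integral E (s
  k) u - v)) + 2 * sq_error (s k)) @ \oo --> 2 * (0 * 0) + 2 * (0 : R).
  apply: cvgD; apply: cvgM; [exact: cvg_cst| |exact: cvg_cst|exact: serr].
  by apply: cvgM; exact: sv.
rewrite !mulr0 addr0 in l0.
have d0 : d <= 0 by apply: (cvgr_to_ge l0); exact: nearW.
apply/eqP; rewrite -subr_eq0; apply/eqP/ComplexField.Normc.eq0_normc.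
apply/eqP; rewrite -sqrf_eq0 -sqmodE eq_le d0 /=; exact: sqmod_ge0.
Qed.

End spectral_integrals.

(** * Approximation by step functions and the unitary group *)

Section step_approximation.
Context (R : realType).
Local Notation step := (R[i] * (R * R))%type.
Variables (h : R -> R[i]) (M : R).
Hypotheses (cRe : continuous (fun x => complex.Re (h x)))
  (cIm : continuous (fun x => complex.Im (h x))) (bh : forall x, normc (h x) <= M).

Definition grid_step (p : nat -> R) m : seq step :=
  [seq (h (p j.+1), (p j, p j.+1)) | j <- iota 0 m].

Section grid.
Variable p : nat -> R.
Hypothesis p_nd : forall j, p j <= p j.+1.

Lemma step_ok_grid m : step_ok (grid_step p m).
Proof. by rewrite /step_ok all_map; apply/allP => j _ /=. Qed.

(** At most one of the disjoint intervals of the grid contains x. *)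
Lemma step_fun_grid m x :
  (p 0 < x <= p m -> exists2 j, p j < x <= p j.+1 & step_fun (grid_step p m) x = h (p
    j.+1)) /\
  (~~ (p 0 < x <= p m) -> step_fun (grid_step p m) x = 0).
Proof.
elim: m => [|m [IH1 IH2]].
  by split => [/andP[]|_]; [rewrite ltNge => /negP|rewrite /step_fun big_nil].
have E1 : step_fun (grid_step p m.+1) x =
    step_fun (grid_step p m) x + h (p m.+1) * (\1_(`]p m, p m.+1]%classic) x)%:C.
  have -> : grid_step p m.+1 = grid_step p m ++ [:: (h (p m.+1), (p m, p m.+1))].
    by rewrite /grid_step -[in LHS]addn1 iotaD map_cat.
  by rewrite /step_fun big_cat big_seq1.
have pm0 : p 0 <= p m by elim: (m) => // k /le_trans; apply.
have indE : (\1_(`]p m, p m.+1]%classic) x : R) = (p m < x <= p m.+1)%R%:R.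
  have mE : (x \in `]p m, p m.+1]%classic) = (p m < x <= p m.+1).
    by apply/idP/idP; rewrite inE /= in_itv.
  by rewrite indicE mE.
rewrite E1 indE; have [xm|mx] := leP x (p m).
  rewrite /= mulr0 addr0 (le_trans xm (p_nd m)) andbT; split => [x0|].
    by apply: IH1; rewrite x0 xm.
  by move=> x0; apply: IH2; rewrite xm andbT.
rewrite /= (le_lt_trans pm0 mx) /=; have s0 : step_fun (grid_step p m) x = 0.
  by apply: IH2; rewrite [x <= _]leNgt mx andbF.
rewrite s0 add0r; split => [xm1|/negPf->]; last by rewrite mulr0.
by exists m; rewrite ?mx ?xm1 ?mulr1.
Qed.

End grid.

(** Step 1/(n+1), so that 2 (n+1)^2 steps lead from -(n+1) to n+1. *)
Definition mesh n j : R := - n.+1%:R + j%:R / n.+1%:R.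

Definition approx n : seq step := grid_step (mesh n) (2 * n.+1 * n.+1).

Lemma mesh_nd n j : mesh n j <= mesh n j.+1.
Proof. by rewrite lerD2l ler_pM2r ?invr_gt0// ler_nat. Qed.

Lemma mesh_step n j : mesh n j.+1 - mesh n j = n.+1%:R^-1.
Proof. by rewrite /mesh -[j.+1]addn1 natrD mulrDl mul1r; ring. Qed.

Lemma step_ok_approx n : step_ok (approx n).
Proof. exact: step_ok_grid (mesh_nd n) _. Qed.

Lemma normc_approx n x : normc (step_fun (approx n) x) <= M.
Proof.
have [s1 s0] := step_fun_grid (mesh_nd n) (2 * n.+1 * n.+1) x.
have [/s1[j _ ->]//|/s0 ->] := boolP (mesh n 0 < x <= mesh n (2 * n.+1 * n.+1)).
by rewrite (_ : 0 = 0%:C)// normc_real normr0 (le_trans (normc_ge0 _) (bh 0)).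
Qed.

Lemma approx_near n x : `|x| < n.+1%:R ->
  exists2 y, `|x - y| <= n.+1%:R^-1 & step_fun (approx n) x = h y.
Proof.
rewrite ltr_norml => /andP[lx xr].
have [s1 _] := step_fun_grid (mesh_nd n) (2 * n.+1 * n.+1) x.
have n0 : n.+1%:R != 0 :> R by rewrite pnatr_eq0.
have px : mesh n 0 < x <= mesh n (2 * n.+1 * n.+1).
  apply/andP; split; first by rewrite /mesh mul0r addr0.
  rewrite /mesh !natrM mulfK//; have : 0 <= n.+1%:R :> R by []; move: (ltW xr); lra.
have [j /andP[jx xj] ->] := s1 px; exists (mesh n j.+1) => //.
rewrite ler0_norm ?subr_le0// opprB -(mesh_step n j) lerD2l lerN2.
exact: ltW.
Qed.

Lemma approx_cvg x : (fun n => sqmod (h x - step_fun (approx n) x)) @ \oo --> (0 : R).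
Proof.
pose g y := sqmod (h x - h y).
have cg : continuous g.
  have gE : g = (fun y => (complex.Re (h x) - complex.Re (h y)) * (complex.Re (h x) -
    complex.Re (h y)) +
     (complex.Im (h x) - complex.Im (h y)) * (complex.Im (h x) - complex.Im (h y))).
    by apply/funext => y; rewrite /g /sqmod; case: (h x) (h y) => a b [c e] /=;
      rewrite !expr2.
  rewrite gE => y.
  have cb (k : R) (q : R -> R) : continuous q -> (fun z => k - q z) @ y --> k - q y.
    by move=> cq; apply: cvgB; [exact: cvg_cst|exact: cq].
  by apply: cvgD; apply: cvgM; exact: cb.
have gx : g x = 0 by rewrite /g subrr /sqmod /= expr0n /= addr0.
have g0 : g y @[y --> x] --> (0 : R) by rewrite -gx; exact: cg.
apply/cvgrPdist_lt => e e0; have /cvgrPdist_lt /(_ _ e0) := g0.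
move=> /nbhs_ballP[r /= r0 gr].
near=> n; have xn : `|x| < n.+1%:R.
  near: n; exists (Num.bound `|x|) => // n /= xn.
  by rewrite (lt_le_trans (archi_boundP (normr_ge0 x)))// ler_nat leqW.
have [y xy ->] := approx_near xn; apply: gr; rewrite /ball /=.
apply: (le_lt_trans xy); near: n.
have := @cvg_harmonic R => /cvgrPdist_lt /(_ _ r0); apply: filterS => n.
by rewrite sub0r normrN ger0_norm ?harmonic_ge0.
Unshelve. all: by end_near. Qed.

(** Dominated convergence: the approximants are bounded by the bound of h and
    converge pointwise by continuity of h. *)
Lemma sq_error_approx (H : preHilbertType R) (E : spectral_family H) (u : H) :
  (fun n => sq_error E u h (approx n)) @ \oo --> (0 : R).
Proof.
have mh : cmeasurable (setT : set (measurableTypeR R)) h by exact: cmeasurable_continuous.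
rewrite -[X in _ --> X](_ : \int[spectral_measure E u]_x (cst 0 x : R) = 0); last first.
  by rewrite /Rintegral integral0.
apply: (Rintegral_dominated_cvg _ _ (integrable_cst (spectral_measure E u) ((M + M) ^+
  2))) => [n|x|n x].
- exact: (measurable_sqmod (cmeasurable_error mh _)).
- exact: approx_cvg.
- rewrite ger0_norm ?sqmod_ge0// sqmodE.
  have b : normc (h x - step_fun (approx n) x) <= M + M.
    by rewrite (le_trans (le_normcD _ _))// normcN lerD// normc_approx.
  by rewrite lerXn2r ?nnegrE ?normc_ge0// (le_trans (normc_ge0 _) b).
Qed.

End step_approximation.

Section unitary_group.
Context (R : realType) (H : preHilbertType R) (E : spectral_family H) (u : H).

Lemma inner_exp_mitA (t : R) : is_hilbert H -> hnorm u = 1 ->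
  inner (exp_mitA E t u) u = charfun (spectral_measure E u) t.
Proof.
move=> hilb u1; pose h (l : R) : R[i] := expi (- (t * l)).
have ct : continuous (fun l : R => - (t * l)).
  by move=> l; apply: cvgN; apply: cvgM; [exact: cvg_cst|exact: cvg_id].
have cRe : continuous (fun x => complex.Re (h x)).
  by move=> x; apply: (@continuous_comp _ _ _ (fun l : R => - (t * l)) (@cos R));
    [exact: ct|exact: continuous_cos].
have cIm : continuous (fun x => complex.Im (h x)).
  by move=> x; apply: (@continuous_comp _ _ _ (fun l : R => - (t * l)) (@sin R));
    [exact: ct|exact: continuous_sin].
have bh x : normc (h x) <= 1 by rewrite normc_expi.
have mh : cmeasurable (setT : set (measurableTypeR R)) h by exact: cmeasurable_continuous.
have ex : exists v, spectral_integral E h u v.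
  apply: (spectral_integral_exists mh bh hilb); exists (approx h); split.
    exact: step_ok_approx.
  exact: (sq_error_approx cRe cIm bh).
have [v hv] := ex.
by apply: (inner_spectral_integral mh bh u1); exact: (xgetPex 0 ex).
Qed.

End unitary_group.

(** * The spectral distribution and its Fourier transform *)

Theorem proposition4p1 (R : realType) (n d : nat)
  (* the domain M, the functions K and delta *)
  (X : weighted_domain R n)
  (* the Lie group G and its action on M *)
  (G : topGroupType) (L : lie_structure R d G)
  (act : G -> 'rV[R[i]]_n -> 'rV[R[i]]_n)
  (act_M : transitive_holomorphic_action L (dom X) act)
  (mu_invariant : forall (g : G) (B : set (borel_Cn R n)),
    measurable B -> B `<=` dom X ->
    dens_measure X (act g @` B) = dens_measure X B)
  (* H is a Hilbert space with reproducing kernel, normalised by K *)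
  (H_hilbert : is_hilbert (holL2 X))
  (e : 'rV[R[i]]_n -> holL2 X)
  (e_reproducing : forall (f : holL2 X) z, dom X z -> f z = inner f (e z))
  (e_normalized : forall x, dom X x -> inner (e x) (e x) = (kern X x)%:C)
  (* the cocycle alpha and the unitary representation of G on H *)
  (alpha : G -> 'rV[R[i]]_n -> R[i])
  (alpha_neq0 : forall g x, dom X x -> alpha g x != 0)
  (alpha_cocycle : forall g1 g2 x, dom X x ->
    alpha (g1 * g2)%g x = alpha g1 (act g2 x) * alpha g2 x)
  (kern_alpha : forall g x, dom X x ->
    kern X (act g x) = (sqmod (alpha g x))^-1 * kern X x)
  (rho : G -> holL2 X -> holL2 X)
  (rhoE : forall g (f : holL2 X) x, dom X x ->
    rho g f x = alpha g^-1%g x * f (act g^-1%g x))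
  (rho_unitary : unitary_representation rho)
  (* the self-adjoint operator A = \int l dE_l *)
  (A : operator (holL2 X)) (A_sa : self_adjoint A)
  (E : spectral_family (holL2 X)) (A_E : spectral_decomposition A E)
  (f : holL2 X) (f_unit : hnorm f = 1) :
  let mu_f := spectral_measure E f in
  let F_f := fun t : R => inner (exp_mitA E t f) f in
  (tempered (distr_fun F_f) /\
   eq_tempered (distr_measure mu_f) (distr_fourier_inv (distr_fun F_f))) /\
  (cintegrable (@lebesgue_measure R) setT F_f ->
   mu_f `<< @lebesgue_measure R /\
   has_density mu_f (fun l : R => ((2 * pi)^-1)%:C *
     cintegral (@lebesgue_measure R) setT (fun t : R => expi (t * l) * F_f t))).
Proof.
move=> mu_f F_f.
have FE : F_f = charfun mu_f.
  by apply/funext => t; exact: inner_exp_mitA H_hilbert f_unit.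
rewrite FE; have mF := cmeasurable_charfun mu_f; have bF := normc_charfun mu_f.
split; first split.
- exact: tempered_distr_fun mF bF.
- split.
  + exact: tempered_distr_measure.
  + exact: tempered_distr_fourier_inv mF bF.
  + by move=> phi; exact: fourier_inversion.
- move=> iF; split; first exact: (charfun_abs_continuous iF).
  exact: (charfun_has_density iF).
Qed.
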